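(* Let $\mathcal{T}$ be a tree chosen uniformly at random from the labelled trees on the vertex set $[n]$, and let $c(n)$ be the number of sub-trees of $\mathcal{T}$. Then asymptotically almost surely $c(n)\le 1.41960^n$.
   Context: A sub-tree is a non-empty vertex subset inducing a connected subgraph. An event holds asymptotically almost surely if its probability tends to $1$ as $n\to\infty$. *)

(* Defs.v *)
From HB Require Import structures.
From mathcomp Require Export all_boot all_order all_algebra.
From mathcomp Require Export boolp classical_sets reals topology normedtype.
From mathcomp Require Export sequences.

Set Implicit Arguments.
Unset Strict Implicit.
Unset Printing Implicit Defensive.

Export Order.TTheory GRing.Theory Num.Theory.
Export numFieldNormedType.Exports.

(* A simple graph with vertex set V is given by its set of edges, each edge   *)
(* being a two-element set of vertices.                                       *)
Definition simple_graph (V : finType) (E : {set {set V}}) : Prop :=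
  forall e : {set V}, e \in E -> #|e| = 2.

Definition adj (V : finType) (E : {set {set V}}) : rel V :=
  fun x y => [set x; y]%SET \in E.

Definition induced_adj (V : finType) (E : {set {set V}}) (S : {set V}) :
    rel V :=
  fun x y => [&& x \in S, y \in S & adj E x y].

Definition connected_on (V : finType) (E : {set {set V}}) (S : {set V}) :
    Prop :=
  forall x y : V, x \in S -> y \in S -> connect (induced_adj E S) x y.

(* The bound on the size is needed because [:: x; y] is a ucycle as soon as   *)
(* x and y are adjacent.                                                      *)
Definition acyclic (V : finType) (E : {set {set V}}) : Prop :=
  forall c : seq V, ucycle (adj E) c -> size c < 3.

Definition is_tree (V : finType) (E : {set {set V}}) : Prop :=
  [/\ simple_graph E, 0 < #|V|, connected_on E [set: V]%SET & acyclic E].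

Definition is_subtree (V : finType) (E : {set {set V}}) (S : {set V}) : Prop :=
  S != finset.set0 /\ connected_on E S.

Definition nb_subtrees (V : finType) (E : {set {set V}}) : nat :=
  #|[set S : {set V} | `[< is_subtree E S >] ]%SET|.

Definition labelled_trees (n : nat) : {set {set {set 'I_n}}} :=
  [set E : {set {set 'I_n}} | `[< is_tree E >] ]%SET.

Definition uniform_prob (R : realType) (T : finType) (Omega : {set T})
    (P : pred T) : R :=
  (#|[set t in Omega | P t]%SET|%:R / #|Omega|%:R)%R.

(* Main.v *)
(**
  The argument is a Chernoff bound for [c(n)], carried out with a fractional
  moment of order [1/64].  Root the tree at a vertex and describe it by its
  parent function [p].  Sets of vertices closed under [p] (ideals) are, up to the
  empty set, the sub-trees containing the root, and every sub-tree is recovered from its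
  top vertex and an ideal, so [c(n) <= n * I(p)] with [I(p)] the number of ideals.

  [I] is multiplicative over the components of a forest and a tree with root
  removed satisfies [I(tree) = 1 + I(forest)].  Hence, if [F_N] denotes the
  exponential generating function (at a point [z]) of forests with [I = N], then
  [F] is the Dirichlet exponential of [z F_(d-1)], and with [phi N = N^(1/64)]
  the tree sum [Y = z * sum_N F_N phi(N+1)] satisfies
    [Y <= z * sum_(N < 512) F_N (phi(N+1) - w phi N) + w z e^Y],
  where [w = (1 + 1/512)^(1/64)] bounds [phi(N+1) / phi N] for [N >= 512].  The
  finitely many numbers [F_N], [N < 512], are bounded by an explicit computation,
  after which [Y <= 1.00544] for [z = 0.994541 / e].  Comparing with the at least
  [n^(n-2)] labelled trees and using [0.994541^64 * 1.4196 > 1], Markov's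
  inequality shows that [c(n) > 1.4196^n] has probability [O(1/n)].
*)
From Stdlib Require Import BinNat NArith.
Require Import Defs.
From mathcomp Require Import zify ring lra fintype finset exp.

Set Implicit Arguments.
Unset Strict Implicit.
Unset Printing Implicit Defensive.

(** * Forests as parent functions *)

Section ParentFunctions.
Variable V : finType.
Implicit Types (p q : {ffun V -> V}) (A B S : {set V}) (x y r : V).

(** Induction along the orbit from [x] to [r], run backwards from its end. *)
Lemma fconnect_ind (p : V -> V) (P : V -> Prop) r :
  P r -> (forall y, P (p y) -> P y) -> forall x, fconnect p x r -> P x.
Proof.
move=> Pr PS x /iter_findex; move: (findex p x r) => k.
elim: k x => [|k IH] x; first by move=> /= ->.
by rewrite iterSr => /IH/PS.
Qed.

Lemma fconnect_stable (p : V -> V) S x y :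
  (forall u, u \in S -> p u \in S) -> fconnect p x y -> x \in S -> y \in S.
Proof.
move=> clS /iter_findex <- xS.
by elim: (findex p x y) => [|k IH] //=; apply: clS.
Qed.

Lemma fconnect_fixed (p : V -> V) x y : p x = x -> fconnect p x y -> y = x.
Proof.
move=> px /(@fconnect_stable p [set x]) h; apply/set1P/h; last exact: set11.
by move=> u /set1P ->; rewrite px set11.
Qed.

Definition rooted p := [forall x, exists r, fconnect p x r && (p r == r)].

(** Turning some vertices into roots only cuts orbits short, so every vertex still reaches a fixed
    point. *)
Lemma rooted_sub p q :
  (forall x, q x = x \/ q x = p x) -> rooted p -> rooted q.
Proof.
move=> qp /forallP rp; apply/forallP => x; have /existsP[r /andP[xr /eqP pr]] := rp x.
move: x xr; apply: fconnect_ind.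
  by apply/existsP; exists r; rewrite connect0; case: (qp r) => ->; rewrite ?pr eqxx.
move=> y; case: (qp y) => qy /existsP[r' /andP[h1 h2]].
  by apply/existsP; exists y; rewrite connect0 qy eqxx.
by apply/existsP; exists r'; rewrite h2 fconnect_eqVf qy h1 orbT.
Qed.

(** Roots are the fixed points in [A], and [rooted] excludes longer cycles. Fixing every vertex
    outside [A] gives each forest on [A] a single representative. *)
Definition forests A : {set {ffun V -> V}} :=
  [set p : {ffun V -> V} | [&& [forall (x | x \notin A), p x == x], [forall x in A, p x \in A]
             & rooted p]].

Definition roots_of A p : {set V} := [set x in A | p x == x].

Definition ideals A p : {set {set V}} :=
  [set S : {set V} | (S \subset A) && [forall x in S, p x \in S]].

Lemma forestsP A p :
  reflect [/\ forall x, x \notin A -> p x = x, forall x, x \in A -> p x \in A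
            & rooted p] (p \in forests A).
Proof.
rewrite inE; apply: (iffP and3P) => -[h1 h2 h3]; split=> //.
- by move=> x xA; have /implyP/(_ xA)/eqP := forallP h1 x.
- by move=> x xA; have /implyP/(_ xA) := forallP h2 x.
- by apply/forallP => x; apply/implyP => /h1 ->.
- by apply/forallP => x; apply/implyP => /h2 ->.
Qed.

Lemma idealsP A p S :
  reflect (S \subset A /\ forall x, x \in S -> p x \in S) (S \in ideals A p).
Proof.
rewrite inE; apply: (iffP andP) => -[h1 h2]; split=> //.
- by move=> x xA; have /implyP/(_ xA) := forallP h2 x.
- by apply/forallP => x; apply/implyP => /h2 ->.
Qed.

Lemma card_ideals_gt0 A p : 0 < #|ideals A p|.
Proof.
apply/card_gt0P; exists set0; apply/idealsP.
by split=> [|x]; rewrite ?sub0set // in_set0.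
Qed.

Lemma card_ideals_leq A p : #|ideals A p| <= 2 ^ #|A|.
Proof.
rewrite -card_powerset; apply: subset_leq_card; apply/subsetP => S.
by case/idealsP => sSA _; rewrite powersetE.
Qed.

Lemma eq_ideals A p q : {in A, p =1 q} -> ideals A p = ideals A q.
Proof.
move=> pq; apply/setP => S.
by apply/idealsP/idealsP => -[/subsetP sSA clS];
  split=> [|x xS]; try (exact/subsetP); move: (clS _ xS); rewrite pq ?sSA.
Qed.

Lemma forests_no_root A p : p \in forests A -> #|roots_of A p| = 0 -> A = set0.
Proof.
case/forestsP => h1 h2 /forallP h3 /eqP; rewrite cards_eq0 => /eqP r0.
apply/setP => x; rewrite in_set0; apply/negP => xA.
have /existsP[r /andP[xr pr]] := h3 x.
have : r \in roots_of A p by rewrite inE pr andbT (fconnect_stable h2 xr).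
by rewrite r0 in_set0.
Qed.

Lemma card_ideals0 p : #|ideals set0 p| = 1.
Proof.
rewrite -(cards1 (set0 : {set V})); congr #|pred_of_set _|.
apply/setP => S; rewrite in_set1 -subset0.
apply/idealsP/idP => [[]//|sS]; split=> // x.
by move: sS; rewrite subset0 => /eqP ->; rewrite in_set0.
Qed.

Definition descendants p r : {set V} := [set x | fconnect p x r].

(** Deletes the root [r] of the tree on [B]; its children become roots. *)
Definition cut B r p : {ffun V -> V} :=
  [ffun x => if x \in B :\ r then (if p x == r then x else p x) else x].

Definition restrict B p : {ffun V -> V} := [ffun x => if x \in B then p x else x].

(** The component of a root is closed under [p] in both directions, which lets ideals split along
    it. *)
Lemma desc_parent p r x : p r = r -> (p x \in descendants p r) = (x \in descendants p r).
Proof.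
move=> pr; rewrite !inE [RHS]fconnect_eqVf; case: eqVneq => //= ->.
by rewrite pr connect0.
Qed.

Lemma descendants_sub A p r : p \in forests A -> r \in A -> descendants p r \subset A.
Proof.
case/forestsP => h1 h2 h3 rA; apply/subsetP => x; rewrite inE => xr.
apply: contraT => xA; have rx := fconnect_fixed (h1 _ xA) xr.
by rewrite -rx rA in xA.
Qed.

Lemma cut_forest A p r : p r = r -> p \in forests A ->
  cut (descendants p r) r p \in forests (descendants p r :\ r).
Proof.
move=> pr /forestsP[h1 h2 h3]; apply/forestsP; split.
- by move=> x xB; rewrite ffunE (negPf xB).
- move=> x xB; rewrite ffunE xB; case: eqVneq => // pxr.
  by move: xB; rewrite in_setD1 [in X in _ -> X]in_setD1 pxr desc_parent // => /andP[].
- apply: rooted_sub h3 => x; rewrite ffunE; case: ifP => _; last by left.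
  by case: ifP => _; [left | right].
Qed.

Lemma restrict_forest A p r : p r = r -> p \in forests A ->
  restrict (A :\: descendants p r) p \in forests (A :\: descendants p r).
Proof.
move=> pr /forestsP[h1 h2 h3]; apply/forestsP; split.
- by move=> x xB; rewrite ffunE (negPf xB).
- move=> x xB; rewrite ffunE xB; move: xB.
  by rewrite !in_setD desc_parent // => /andP[-> /h2].
- apply: rooted_sub h3 => x; rewrite ffunE; case: ifP => _; last by left.
  by right.
Qed.

Lemma roots_restrict A p r : p r = r -> r \in A ->
  #|roots_of (A :\: descendants p r) (restrict (A :\: descendants p r) p)|.+1
  = #|roots_of A p|.
Proof.
move=> pr rA; rewrite [RHS](cardsD1 r) [r \in _]inE rA pr eqxx add1n.
congr (#|pred_of_set _|.+1); apply/setP => x.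
rewrite in_setD1 !inE ffunE !inE; have [-> | xr] := eqVneq x r.
  by rewrite connect0.
case: (boolP (x \in A)) => xA; rewrite ?andbF //= ?andbT.
case: (boolP (fconnect p x r)) => /= h; last by [].
by apply/esym/eqP => /fconnect_fixed /(_ h) rx; rewrite rx eqxx in xr.
Qed.

(** Inside [A], [B] is a union of components. An ideal is therefore an independent choice of its
    traces on [B] and on [A :\: B]. *)
Lemma card_ideals_split A B p : B \subset A ->
  (forall x, x \in A -> (p x \in B) = (x \in B)) ->
  #|ideals A p| = #|ideals B p| * #|ideals (A :\: B) p|.
Proof.
move=> sBA pB; rewrite -cardsX.
pose f (S : {set V}) := (S :&: B, S :\: B).
have inj : injective f by move=> S S' [e1 e2]; rewrite -(setID S B) e1 e2 setID.
rewrite -(card_imset _ inj); congr #|pred_of_set _|; apply/setP => -[S1 S2].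
apply/imsetP/setXP => [[S /idealsP[/subsetP sSA clS] [-> ->]] | ].
  split; apply/idealsP; split.
  - exact: subsetIr.
  - by move=> x /setIP[xS xB]; rewrite inE clS //= pB ?sSA.
  - by apply: setSD; apply/subsetP.
  - by move=> x /setDP[xS xB]; rewrite inE clS //= pB ?sSA ?xB.
case=> /idealsP[s1 c1] /idealsP[s2 c2]; exists (S1 :|: S2).
  apply/idealsP; split.
    by rewrite subUset (subset_trans s1 sBA) (subset_trans s2) // subsetDl.
  by move=> x /setUP[/c1|/c2] h; rewrite inE h ?orbT.
move: s2; rewrite subsetD => /andP[_ d2]; congr pair.
  by rewrite setIUl (setIidPl s1) (disjoint_setI0 d2) setU0.
by rewrite setDUl (setDidPl d2); move: s1; rewrite -setD_eq0 => /eqP ->; rewrite set0U.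
Qed.

(** Every vertex of [B] leads to [r], so a non-empty ideal contains [r], and deleting [r] leaves an
    ideal of the cut forest. The empty ideal accounts for the successor. *)
Lemma card_ideals_cut B r p : p r = r -> r \in B ->
  (forall x, x \in B -> fconnect p x r) ->
  #|ideals B p| = #|ideals (B :\ r) (cut B r p)|.+1.
Proof.
move=> pr rB Br.
have -> : ideals B p =
    set0 |: [set r |: S | S in ideals (B :\ r) (cut B r p)].
  apply/setP => S; rewrite in_setU1; apply/idealsP/orP => [[sSB clS]|[/eqP ->|]].
  - have [->|/set0Pn[x xS]] := eqVneq S set0; [by left|right].
    have rS : r \in S := fconnect_stable clS (Br x (subsetP sSB x xS)) xS.
    apply/imsetP; exists (S :\ r); last by rewrite setD1K.
    apply/idealsP; split; first exact: setSD.
    move=> y yS; rewrite ffunE; case: ifP => // _; case: eqVneq => // pyr.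
    by move: yS; rewrite !in_setD1 pyr => /andP[_ /clS].
  - by split=> [|x]; rewrite ?sub0set // in_set0.
  - case/imsetP => S' /idealsP[sS' clS'] ->; split.
      by rewrite subUset sub1set rB (subset_trans sS') // subD1set.
    move=> x /setU1P[->|xS]; first by rewrite pr setU11.
    have := clS' x xS; rewrite ffunE (subsetP sS' _ xS) in_setU1.
    by case: eqVneq => //= _ ->.
rewrite cardsU1 card_in_imset.
  rewrite (_ : _ \notin _ = true) //; apply/imsetP => -[S _ /setP/(_ r)].
  by rewrite setU11 in_set0.
move=> S S' /idealsP[/subsetP s _] /idealsP[/subsetP s' _] eS.
have nr (U : {set V}) : {subset U <= B :\ r} -> U = (r |: U) :\ r.
  by move=> sU; rewrite setU1K //; apply/negP => /sU; rewrite in_setD1 eqxx.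
by rewrite (nr S) // eS -nr.
Qed.

Lemma card_ideals_decomp A p r : p \in forests A -> r \in A -> p r = r ->
  let B := descendants p r in
  #|ideals A p| = #|ideals (B :\ r) (cut B r p)|.+1
                  * #|ideals (A :\: B) (restrict (A :\: B) p)|.
Proof.
move=> fp rA pr B; rewrite (@card_ideals_split A B) ?descendants_sub //; last first.
  by move=> x _; rewrite desc_parent.
rewrite (@card_ideals_cut B r) ?inE ?connect0 //; last by move=> x; rewrite inE.
by congr (_ * #|pred_of_set _|); apply: eq_ideals => x xB; rewrite ffunE xB.
Qed.

(** Only a fixed point [x] of the cut map could hide the value of [p]. If such an [x] lies in the
    component and differs from [r], it was a child of [r], since [p x = x] would keep it from
    reaching [r]. *)
Lemma decomp_inj A r p p' : p \in forests A -> p' \in forests A ->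
  p r = r -> p' r = r -> descendants p r = descendants p' r ->
  cut (descendants p r) r p = cut (descendants p r) r p' ->
  restrict (A :\: descendants p r) p = restrict (A :\: descendants p r) p' -> p = p'.
Proof.
move=> /forestsP[h1 _ _] /forestsP[h1' _ _] pr pr' eB /ffunP ec /ffunP er.
apply/ffunP => x; have [->|xr] := eqVneq x r; first by rewrite pr pr'.
case: (boolP (x \in A)) => xA; last by rewrite h1 ?h1'.
case: (boolP (x \in descendants p r)) => xB; last first.
  by have := er x; rewrite !ffunE in_setD xB xA.
have fix_eq (q : {ffun V -> V}) : x \in descendants q r -> q x <> x.
  by rewrite inE => xq /fconnect_fixed /(_ xq) rx; rewrite rx eqxx in xr.
have := ec x; rewrite !ffunE in_setD1 xr xB /=.
case: eqVneq => [->|_]; case: eqVneq => [->|_] //.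
  by move=> /esym e; case: (fix_eq p' _ e); rewrite -eB.
by move=> e; case: (fix_eq p xB e).
Qed.

End ParentFunctions.

(** * Counting forests by number of roots and ideals *)

Section ForestCounts.
Variable V : finType.
Implicit Types (p q : {ffun V -> V}) (A B S : {set V}) (x y r : V).

Definition class_forests A k N : {set {ffun V -> V}} :=
  [set p in forests A | (#|roots_of A p| == k) && (#|ideals A p| == N)].

(** The maximum makes the count a function of the size [m] alone; the later arguments ask only for
    upper bounds. *)
Definition fcount m k N := \max_(A : {set V} | #|A| == m) #|class_forests A k N|.

Lemma fcount_ge A k N : #|class_forests A k N| <= fcount #|A| k N.
Proof. exact: (@leq_bigmax_cond _ (fun B : {set V} => #|B| == #|A|)). Qed.

(** Here [d] counts the ideals below the marked root, whose tree then has [d.+1], and [e] those of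
    the remaining forest. The ranges suffice because there are at most [2 ^ #|V|] ideals and [#|V|]
    roots. *)
Definition conv_count a b k N :=
  \sum_(d < (2 ^ #|V|).+1) \sum_(e < (2 ^ #|V|).+1) \sum_(k' < #|V|.+1)
     (d.+1 * e == N) * (fcount a k' d * fcount b k e).

(** A forest in which [r] is a root with component [B] is determined by its [cut] and [restrict]
    parts. Sorting by the ideal counts of both parts and the root count of the first yields the
    terms of the convolution. *)
Lemma marked_leq A B r k N : r \in B -> B \subset A ->
  #|[set p in class_forests A k.+1 N | (p r == r) && (descendants p r == B)]|
  <= conv_count #|B|.-1 (#|A| - #|B|) k N.
Proof.
move=> rB sBA; set X := [set p in _ | _]; pose L := 2 ^ #|V|.
have idL A' p : #|ideals A' p| < L.+1.
  by rewrite ltnS (leq_trans (card_ideals_leq _ _)) // leq_exp2l // max_card.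
have rtL A' p : #|roots_of A' p| < #|V|.+1 by rewrite ltnS max_card.
pose h p : 'I_L.+1 * ('I_L.+1 * 'I_#|V|.+1) :=
  (Ordinal (idL (B :\ r) (cut B r p)),
   (Ordinal (idL (A :\: B) (restrict (A :\: B) p)),
    Ordinal (rtL (B :\ r) (cut B r p)))).
rewrite -sum1_card (partition_big h xpredT) //=.
rewrite /conv_count; under [X in _ <= X]eq_bigr => d _ do rewrite pair_big /=.
rewrite pair_big /=; apply: leq_sum => -[d [e k']] _ /=.
rewrite sum1dep_card; set Y := [set p | _].
have [->|[p0 p0Y]] := set_0Vmem Y; first by rewrite cards0.
have YP p : p \in Y ->
  [/\ p \in forests A, p r = r, descendants p r = B, #|roots_of A p| = k.+1 &
   [/\ #|ideals A p| = N, #|ideals (B :\ r) (cut B r p)| = d,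
     #|ideals (A :\: B) (restrict (A :\: B) p)| = e
     & #|roots_of (B :\ r) (cut B r p)| = k']].
  rewrite inE => /andP[]; rewrite !inE => /andP[/andP[h1 /andP[/eqP h2 /eqP h3]]].
  by move=> /andP[/eqP h4 /eqP h5] /eqP[<- <- <-].
have rA : r \in A := subsetP sBA _ rB.
have -> : d.+1 * e == N.
  have [fp pr eB _ [<- <- <- _]] := YP _ p0Y.
  by rewrite (card_ideals_decomp fp rA pr) eB.
rewrite mul1n.
have -> : #|B|.-1 = #|B :\ r| by rewrite (cardsD1 r B) rB.
have -> : #|A| - #|B| = #|A :\: B| by rewrite cardsD (setIidPr sBA).
apply: leq_trans (leq_mul (fcount_ge _ _ _) (fcount_ge _ _ _)).
rewrite -cardsX -(@card_in_imset _ _ (fun p => (cut B r p, restrict (A :\: B) p))).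
  apply: subset_leq_card; apply/subsetP => _ /imsetP[p pY ->].
  have [fp pr eB rk [_ hd he hk]] := YP _ pY.
  rewrite inE /= !inE hd he hk !eqxx !andbT -eB.
  move: (cut_forest pr fp); rewrite inE => -> /=.
  move: (restrict_forest pr fp); rewrite inE => -> /=.
  by rewrite -eqSS roots_restrict // rk.
move=> p p' /YP[fp pr eB _ _] /YP[fp' pr' eB' _ _] [e1 e2].
by apply: (decomp_inj fp fp' pr pr'); rewrite eB ?eB'.
Qed.

(* Mark one of the [k.+1] roots and split off its component. *)
Lemma fcount_rec m k N :
  k.+1 * fcount m k.+1 N <=
  \sum_(j < m.+1) 'C(m, j) * (j * conv_count j.-1 (m - j) k N).
Proof.
set rhs := (X in _ <= X); rewrite /fcount.
elim/big_rec: _ => [|A x /eqP Am hx]; first by rewrite muln0.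
rewrite maxnMr geq_max hx andbT.
set C := class_forests A k.+1 N.
(* Double counting of the pairs of a forest in [C] and one of its roots. *)
have -> : k.+1 * #|C| = \sum_(p in C) \sum_(r in roots_of A p) 1.
  rewrite mulnC -sum_nat_const; apply: eq_bigr => p.
  by rewrite sum1_card !inE => /andP[_ /andP[/eqP -> _]].
rewrite pair_big_dep /=.
rewrite (partition_big (fun u : {ffun V -> V} * V => (descendants u.1 u.2, u.2))
  (fun v : {set V} * V => (v.1 \subset A) && (v.2 \in v.1))) /=; last first.
  move=> [p r] /= /andP[]; rewrite inE => /andP[fp _].
  by rewrite !inE => /andP[rA _]; rewrite descendants_sub // connect0.
apply: (@leq_trans (\sum_(v : {set V} * V | (v.1 \subset A) && (v.2 \in v.1))
   conv_count #|v.1|.-1 (m - #|v.1|) k N)).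
  apply: leq_sum => -[B r] /= /andP[sBA rB]; rewrite -Am.
  apply: leq_trans (marked_leq k N rB sBA).
  rewrite sum1dep_card -(@card_in_imset _ _ (fun u : {ffun V -> V} * V => u.1)).
    apply: subset_leq_card; apply/subsetP => _ /imsetP[[p r'] + ->] /=.
    rewrite inE /= => /andP[/andP[pC]]; rewrite [r' \in _]inE => /andP[_ pr'].
    by rewrite inE pC => /eqP[<- <-]; rewrite pr' eqxx.
  move=> [p r1] [p' r2] /=; rewrite !inE /= => /andP[_ /eqP[_ ->]].
  by move=> /andP[_ /eqP[_ ->]] ->.
(* The estimate depends on the component [B] alone; its [#|B|] possible roots give the factor
   [j]. *)
rewrite -(pair_big_dep (fun B : {set V} => B \subset A) (fun B r => r \in B)
  (fun B r => conv_count #|B|.-1 (m - #|B|) k N)) /=.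
have szB (B : {set V}) : B \subset A -> #|B| < m.+1.
  by move=> sBA; rewrite ltnS -Am subset_leq_card.
rewrite (partition_big (fun B : {set V} => inord #|B| : 'I_m.+1) xpredT) //=.
apply: leq_sum => j _; have -> : 'C(m, j) = 'C(#|A|, j) by rewrite Am.
rewrite -cards_draws -sum_nat_const.
rewrite [X in _ <= X](eq_bigl (fun B : {set V} => (B \subset A) && (inord #|B| == j))).
  apply: leq_sum => B /andP[sBA /eqP/(congr1 val)/=]; rewrite inordK ?szB // => <-.
  by rewrite sum_nat_const.
move=> B; rewrite inE; case: (boolP (B \subset A)) => //= sBA.
by rewrite -val_eqE /= inordK ?szB.
Qed.

Lemma fcount_N0 m k : fcount m k 0 = 0.
Proof.
apply/eqP; rewrite -leqn0; apply/bigmax_leqP => A _; rewrite leqn0 cards_eq0.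
apply/eqP; apply/setP => p; rewrite !inE; have := card_ideals_gt0 A p.
by case: #|ideals A p| => //= *; rewrite !andbF.
Qed.

(** A forest without roots lives on the empty set, where the identity is the only forest and the
    empty set the only ideal. *)
Lemma fcount_0_leq m N : fcount m 0 N <= (m == 0) && (N == 1).
Proof.
apply/bigmax_leqP => A /eqP <-.
apply: (@leq_trans #|[set p in [set [ffun x => x] : {ffun V -> V}] |
    (#|A| == 0) && (N == 1)]|); last first.
  case: (_ && _).
    apply: leq_trans (_ : #|[set [ffun x => x] : {ffun V -> V}]| <= _).
      by apply: subset_leq_card; apply/subsetP => p; rewrite inE => /andP[].
    by rewrite cards1.
  by rewrite leqn0 cards_eq0; apply/eqP; apply/setP => p; rewrite !inE andbF.
apply: subset_leq_card; apply/subsetP => p; rewrite inE => /andP[fp /andP[/eqP k0 /eqP <-]].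
have A0 := forests_no_root fp k0; rewrite !inE A0 cards0 card_ideals0 !eqxx andbT.
by rewrite andbT; apply/eqP; apply/ffunP => x; rewrite ffunE; case/forestsP: fp => -> //; rewrite A0 in_set0.
Qed.

Lemma sum_forests_leq (R : realFieldType) A (P : nat -> R) :
  (forall N, 0 <= P N)%R ->
  (\sum_(p in forests A) P #|ideals A p| <=
   \sum_(k < #|V|.+1) \sum_(N < (2 ^ #|V|).+1) (fcount #|A| k N)%:R * P N)%R.
Proof.
move=> P0; pose L := 2 ^ #|V|.
have idL p : #|ideals A p| < L.+1.
  by rewrite ltnS (leq_trans (card_ideals_leq _ _)) // leq_exp2l // max_card.
have rtL p : #|roots_of A p| < #|V|.+1 by rewrite ltnS max_card.
pose h p : 'I_#|V|.+1 * 'I_L.+1 := (Ordinal (rtL p), Ordinal (idL p)).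
rewrite (partition_big h xpredT) //= pair_big /=; apply: ler_sum => -[k N] _ /=.
rewrite (eq_bigr (fun=> P N)); last by move=> p /andP[_ /eqP[_ <-]].
rewrite sumr_const mulr_natl; apply: ler_wpMn2l => //.
apply: leq_trans (fcount_ge _ _ _); apply: subset_leq_card; apply/subsetP => p.
by rewrite inE unfold_in /= => /andP[-> /eqP[<- <-]]; rewrite !eqxx.
Qed.

End ForestCounts.

(** * Trees and arborescences *)

Section Arborescences.
Variables (V : finType) (r0 : V).
Implicit Types (p q : {ffun V -> V}) (E : {set {set V}}) (S : {set V}) (x y : V).

(** With the root [r0] fixed once and for all, each labelled tree has exactly one such parent
    function. *)
Definition arbos : {set {ffun V -> V}} :=
  [set p : {ffun V -> V} | (p r0 == r0) && [forall x, fconnect p x r0]].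

Lemma arbosP p : reflect (p r0 = r0 /\ forall x, fconnect p x r0) (p \in arbos).
Proof.
by rewrite inE; apply: (iffP andP) => -[/eqP h1 h2]; split=> //; apply/forallP.
Qed.

Lemma arbo_fixed p x : p \in arbos -> p x = x -> x = r0.
Proof. by case/arbosP => _ h px; rewrite (fconnect_fixed px (h x)). Qed.

Lemma arbo_antisym p x y : p \in arbos -> fconnect p x y -> fconnect p y x -> x = y.
Proof.
case/arbosP => pr h; have := h x; move: x y.
suff H : forall x, fconnect p x r0 -> forall y, fconnect p x y -> fconnect p y x -> x = y.
  by move=> x y /H; apply.
apply: fconnect_ind => [y ry _|x IH y]; first by rewrite (fconnect_fixed pr ry).
rewrite fconnect_eqVf => /orP[/eqP //|xy] yx.
have px : p x = y by apply: IH => //; apply: connect_trans yx (fconnect1 _ _).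
by rewrite -px; apply/esym/IH; rewrite ?fconnect1 // px.
Qed.

Definition edges p : {set {set V}} := [set [set x; p x] | x in ~: [set r0]].

Lemma adj_sym E : symmetric (adj E).
Proof. by move=> x y; rewrite /adj setUC. Qed.

Lemma set2_inj (a b x y : V) : [set a; b] = [set x; y] ->
  (a = x /\ b = y) \/ (a = y /\ b = x).
Proof.
move=> e; have aP : a \in [set x; y] by rewrite -e set21.
have bP : b \in [set x; y] by rewrite -e set22.
have xP : x \in [set a; b] by rewrite e set21.
have yP : y \in [set a; b] by rewrite e set22.
by case/set2P: aP xP yP; case/set2P: bP => -> -> /set2P[] ? /set2P[] ?; auto.
Qed.

Lemma adj_edges p x y : p \in arbos ->
  adj (edges p) x y = (x != y) && ((p x == y) || (p y == x)).
Proof.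
move=> ap; have [pr _] := arbosP _ ap; apply/imsetP/idP => [[u ur]|/andP[xy]].
  have ur' : u != r0 by move: ur; rewrite !inE.
  have pu : p u != u by apply: contra ur' => /eqP/(arbo_fixed ap) ->.
  by case/set2_inj => -[-> ->]; rewrite eqxx ?orbT andbT // eq_sym.
have nr u v : u != v -> p u = v -> u \in ~: [set r0].
  by move=> uv puv; rewrite !inE; apply: contra uv => /eqP ur; rewrite -puv ur pr.
case/orP => /eqP h; first by exists x; rewrite ?h // (nr x y).
by exists y; [apply: (nr y x) => //; rewrite eq_sym | rewrite h setUC].
Qed.

Lemma edges_simple p : p \in arbos -> simple_graph (edges p).
Proof.
move=> ap e /imsetP[x xr ->]; rewrite cards2.
have -> : x != p x; last by [].
by apply/eqP => /esym/(arbo_fixed ap) xr0; rewrite xr0 !inE eqxx in xr.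
Qed.

Lemma connect_edges p x y : p \in arbos -> connect (adj (edges p)) x y.
Proof.
move=> ap; have [pr h] := arbosP _ ap.
have sy := sym_connect_sym (@adj_sym (edges p)).
have to_r0 u : connect (adj (edges p)) u r0.
  move: u (h u); apply: fconnect_ind => [|u]; first exact: connect0.
  have [->|pu] := eqVneq (p u) u; first by [].
  by apply: connect_trans; apply: connect1; rewrite adj_edges // eq_sym pu eqxx.
by apply: connect_trans (to_r0 x) _; rewrite sy.
Qed.

Definition depth p x := #|[set y | fconnect p x y]|.

Lemma depthS p x : p \in arbos -> p x != x -> depth p x = (depth p (p x)).+1.
Proof.
move=> ap px; rewrite /depth (cardsD1 x) inE connect0 add1n; congr (_.+1).
apply: eq_card => y; rewrite in_setD1 !inE [fconnect p x y]fconnect_eqVf.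
have [->|yx] := eqVneq y x => //=.
apply/esym/negP => h; case/eqP: px; apply: (arbo_antisym ap) => //; exact: fconnect1.
Qed.

(** At a vertex of maximal depth on a cycle, both neighbours must be its parent, which contradicts
    their being distinct. *)
Lemma edges_acyclic p : p \in arbos -> acyclic (edges p).
Proof.
move=> ap c /andP[cyc uc]; rewrite ltnNge; apply/negP => sz.
have [c0 c0c] : exists x, x \in c by case: c sz {cyc uc} => // x s; exists x; rewrite mem_head.
pose x := [arg max_(i > c0 in c) depth p i].
have [xc xmax] : x \in c /\ forall y, y \in c -> depth p y <= depth p x.
  by rewrite /x; case: arg_maxnP.
have [i s rs] := rot_to xc.
have cyc' : cycle (adj (edges p)) (x :: s) by rewrite -rs rot_cycle.
have uc' : uniq (x :: s) by rewrite -rs rot_uniq.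
have sz' : 2 < size (x :: s) by rewrite -rs size_rot.
have parent y : y \in c -> adj (edges p) x y -> y = p x.
  move=> yc; rewrite adj_edges // => /andP[xy /orP[/eqP //|/eqP pyx]].
  have := xmax y yc; rewrite [depth p y]depthS //; first by rewrite pyx ltnn.
  by rewrite pyx.
case: s rs cyc' uc' sz' => [//|y s]; case/lastP: s => [//|s z] rs cyc' uc' _.
have inc u : u \in x :: y :: rcons s z -> u \in c by rewrite -rs mem_rot.
have ey : y = p x.
  apply: parent; first by apply: inc; rewrite !inE eqxx orbT.
  by move: cyc' => /= /andP[].
have ez : z = p x.
  apply: parent; first by apply: inc; rewrite !inE mem_rcons inE eqxx !orbT.
  move: cyc'; rewrite /= rcons_path last_rcons => /andP[_ /andP[_]].
  by rewrite adj_sym.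
by move: uc'; rewrite /= ey -ez mem_rcons mem_head /= andbF.
Qed.

Lemma connect_induced_setT E : connect (induced_adj E setT) =2 connect (adj E).
Proof. by apply: eq_connect => x y; rewrite /induced_adj !inE. Qed.

Lemma edges_tree p : p \in arbos -> is_tree (edges p).
Proof.
move=> ap; split.
- exact: edges_simple.
- by apply/card_gt0P; exists r0.
- by move=> x y _ _; rewrite connect_induced_setT connect_edges.
- exact: edges_acyclic.
Qed.

(** If [p x] and [q x] differ, then [q] orients the edge between [x] and [p x] towards [x]. This
    reversal propagates along the whole [p]-orbit of [x], which then never meets [r0]. *)
Lemma edges_inj : {in arbos &, injective edges}.
Proof.
move=> p q ap aq epq; apply/ffunP => x; apply/eqP; apply/negPn/negP => pq.
have [pr hp] := arbosP _ ap; have [qr hq] := arbosP _ aq.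
have pqE u v : (u != v) && ((p u == v) || (p v == u)) = (u != v) && ((q u == v) || (q v == u)).
  by rewrite -!adj_edges // epq.
have xr : x != r0 by apply: contra pq => /eqP ->; rewrite pr qr.
have neq u : u != r0 -> u != p u.
  by apply: contra => /eqP/esym/(arbo_fixed ap) ->.
have back k : (iter k p x != r0) && (q (iter k.+1 p x) == iter k p x).
  elim: k => [|k /andP[IH1 /eqP IH2]] /=.
    rewrite xr /=; have := pqE x (p x); rewrite (neq _ xr) eqxx /=.
    by move/esym/orP => [/eqP h|//]; rewrite h eqxx in pq.
  set u := iter k p x in IH1 IH2 *; rewrite /= -/u in IH2.
  have pur : p u != r0 by apply: contra IH1 => /eqP h; rewrite -IH2 h qr.
  rewrite pur /=; have := pqE (p u) (p (p u)); rewrite (neq _ pur) eqxx /=.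
  move/esym/orP => [/eqP h|//].
  have ppu : p (p u) = u by rewrite -h.
  have : u = p u.
    apply: (arbo_antisym ap); first exact: fconnect1.
    by rewrite -{2}ppu fconnect1.
  by move/eqP; rewrite (negPf (neq _ IH1)).
by have := back (findex p x r0); rewrite iter_findex // eqxx.
Qed.

(** Each vertex other than [r0] gets as parent a neighbour strictly closer to [r0]. The resulting
    edges lie in [E] and connect all vertices, so any further edge of [E] would close a cycle. *)
Lemma tree_arbo E : is_tree E -> exists2 p, p \in arbos & edges p = E.
Proof.
case=> simE _ connE acE.
pose reach n x := [exists s : n.-tuple V, path (adj E) x s && (last x s == r0)].
have ex_reach x : exists n, reach n x.
  have := connE x r0 (in_setT _) (in_setT _).
  rewrite connect_induced_setT => /connectP[s ps ls].
  by exists (size s); apply/existsP; exists (in_tuple s); rewrite ps -ls eqxx.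
pose d x := ex_minn (ex_reach x).
have dr x : reach (d x) x by rewrite /d; case: ex_minnP.
have dmin x n : reach n x -> d x <= n.
  by rewrite /d; case: ex_minnP => m _; apply.
have dP x : x != r0 -> exists2 y, adj E x y & d y < d x.
  move=> xr; have := dr x; case: (d x) => [|n] /existsP[s] /andP[ps ls].
    by move: ls; rewrite tuple0 /= (negPf xr).
  move: ps ls; case/tupleP: s => y s /= /andP[xy ps] ls; exists y => //.
  by rewrite ltnS; apply: dmin; apply/existsP; exists s; rewrite ps.
pose p : {ffun V -> V} :=
  [ffun x => if x == r0 then r0 else odflt x [pick y | adj E x y && (d y < d x)]].
have pP x : x != r0 -> adj E x (p x) /\ d (p x) < d x.
  move=> xr; rewrite /p ffunE (negPf xr); case: pickP => [y /andP[] //|].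
  by have [y h1 h2] := dP x xr => /(_ y); rewrite h1 h2.
have ap : p \in arbos.
  apply/arbosP; split; first by rewrite /p ffunE eqxx.
  move=> x; move: {2}(d x) (leqnn (d x)) => n.
  elim: n x => [|n IH] x dx; have [->|xr] := eqVneq x r0; rewrite ?connect0 //.
    by have [_] := pP x xr; rewrite ltnNge (leq_trans dx).
  rewrite fconnect_eqVf IH ?orbT //; have [_ h] := pP x xr.
  by rewrite -ltnS (leq_trans h).
exists p => //; apply/setP => e; apply/idP/idP => [/imsetP[x]|eE].
  by rewrite !inE => xr ->; have [] := pP x xr.
have subE x y : adj (edges p) x y -> adj E x y.
  rewrite adj_edges // => /andP[xy /orP[]/eqP h].
    have xr : x != r0 by apply: contra xy => /eqP xr; rewrite -h xr /p ffunE eqxx.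
    by rewrite -h; have [] := pP x xr.
  have yr : y != r0.
    by apply: contra xy => /eqP yr; rewrite -h yr /p ffunE eqxx.
  by rewrite adj_sym -h; have [] := pP y yr.
have [x [y [xy exy]]] := cards2P _ (introT eqP (simE e eE)).
apply: contraT => eN; rewrite exy in eE eN.
have /connectP[s ps ls] := connect_edges x y ap.
case/shortenP: ps ls => s' ps' us' _ ls'.
(* Length 0 contradicts [x != y], length 1 puts the edge into [edges p], and a longer path closes up
   to a cycle of [E]. *)
case: s' ps' us' ls' => [|u [|v s']] ps' us' ls'.
- by move: xy; rewrite ls' eqxx.
- by move: ps'; rewrite /= andbT /adj -[u]ls' (negPf eN).
- have : ucycle (adj E) (x :: [:: u, v & s']).
    rewrite /ucycle us' andbT /cycle rcons_path (sub_path subE ps') -ls'.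
    by rewrite adj_sym.
  by move/acE.
Qed.

Lemma is_tree_edgesE E : `[< is_tree E >] = (E \in edges @: arbos).
Proof.
apply/asboolP/imsetP => [/tree_arbo[p ap <-]|[p ap ->]]; first by exists p.
exact: edges_tree.
Qed.

(** The top is a vertex of [S] that is [r0] or has its parent outside [S]. It exists because a
    non-empty set closed under [p] contains [r0]. *)
Lemma subtree_top p S : p \in arbos -> is_subtree (edges p) S ->
  exists2 v, v \in S & forall x, x \in S -> fconnect p x v /\ (x != v -> p x \in S).
Proof.
move=> ap [/set0Pn[x0 x0S] cS]; have [pr hp] := arbosP _ ap.
have [v /andP[vS vtop]] : exists v, (v \in S) && ((v == r0) || (p v \notin S)).
  apply/existsP; apply: contraT => /existsPn h.
  have cl u : u \in S -> p u \in S.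
    by move=> uS; have := h u; rewrite uS negb_or /= negbK => /andP[].
  have := h r0; rewrite (fconnect_stable cl (hp x0) x0S) eqxx.
  by [].
(* A walk in [S] from [w] stays among the descendants of [w]: only the step from [w] to its parent
   could leave them, and that parent is outside [S] or equal to [w]. *)
have top_anc w : w \in S -> (w == r0) || (p w \notin S) -> forall x, x \in S -> fconnect p x w.
  move=> wS wtop x xS; have /connectP[s ps ->] := cS w x wS xS.
  suff walk u : path (induced_adj (edges p) S) u s -> fconnect p u w ->
      fconnect p (last u s) w by apply: walk ps (connect0 _ _).
  elim: s u {ps} => [//|y s IH] u /= + uw.
  move=> /andP[/and3P[_ yS]]; rewrite adj_edges // => /andP[uy uyp] ps; apply: IH ps _.
  case/orP: uyp => /eqP e; last by rewrite fconnect_eqVf e uw orbT.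
  move: uw; rewrite [fconnect p u w]fconnect_eqVf e => /orP[/eqP uw|//].
  case/orP: wtop => [/eqP w0|]; last by rewrite -uw e yS.
  by rewrite -e uw w0 pr eqxx in uy.
exists v => // x xS; split; first exact: top_anc.
(* If the parent of [x] were outside [S], then [x] would be a top as well, and two tops are
   descendants of each other. *)
move=> xv; apply/negPn/negP => pxS; case/eqP: xv; apply: (arbo_antisym ap).
  exact: top_anc.
by apply: (top_anc x) => //; rewrite pxS orbT.
Qed.

(* A sub-tree is encoded by its top vertex [v] and the ideal generated by it,
   obtained by adding the path from [v] to the root. *)
Lemma nb_subtrees_leq p : p \in arbos ->
  nb_subtrees (edges p) <= #|V| * #|ideals setT p|.
Proof.
move=> ap; rewrite /nb_subtrees -(cardsT V) -cardsX.
pose dec (u : V * {set V}) := [set x in u.2 | fconnect p x u.1].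
apply: leq_trans (leq_imset_card dec _); apply: subset_leq_card.
apply/subsetP => S; rewrite inE => /asboolP/(subtree_top ap)[v vS vP].
apply/imsetP; exists (v, S :|: [set y | fconnect p v y]).
  rewrite inE /= in_setT /=; apply/idealsP; split; first exact: subsetT.
  move=> x; rewrite !inE => /orP[xS|vx].
    have [->|xv] := eqVneq x v; first by rewrite fconnect1 orbT.
    by have [_ ->] := vP x xS.
  by rewrite (connect_trans vx (fconnect1 _ _)) orbT.
apply/setP => x; rewrite !inE /=; apply/idP/andP => [xS|[/orP[//|vx] xv]].
  by rewrite xS; split=> //; have [] := vP x xS.
by rewrite (arbo_antisym ap xv vx).
Qed.

Lemma arbo_forest p : p \in arbos -> p \in forests setT.
Proof.
case/arbosP => pr h; apply/forestsP; split=> [x|x|]; rewrite ?inE //.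
by apply/forallP => x; apply/existsP; exists r0; rewrite h pr eqxx.
Qed.

Lemma arbo_descendants p : p \in arbos -> descendants p r0 = setT.
Proof. by case/arbosP => _ h; apply/setP => x; rewrite !inE h. Qed.

Lemma arbo_cut_forest p : p \in arbos -> cut setT r0 p \in forests (setT :\ r0).
Proof.
move=> ap; have [pr h] := arbosP _ ap; have := cut_forest pr (arbo_forest ap).
by rewrite arbo_descendants.
Qed.

Lemma arbo_cut_inj : {in arbos &, injective (cut setT r0)}.
Proof.
move=> p q ap aq e; have [pr _] := arbosP _ ap; have [qr _] := arbosP _ aq.
apply: (decomp_inj (arbo_forest ap) (arbo_forest aq) pr qr).
- by rewrite !arbo_descendants.
- by rewrite arbo_descendants.
- by rewrite arbo_descendants // setDv; apply/ffunP => x; rewrite !ffunE !inE.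
Qed.

Lemma arbo_ideals p : p \in arbos ->
  #|ideals setT p| = #|ideals (setT :\ r0) (cut setT r0 p)|.+1.
Proof. by case/arbosP => pr h; rewrite (@card_ideals_cut _ _ r0) ?inE. Qed.

End Arborescences.

(** * Cayley's lower bound *)

(** The binomial expansion of [(b + k) ^ a.+1], differentiated in [k], multiplied by [k] and taken
    at [b = a.+1]. *)
Lemma binomial_mean a k : a.+1 * (k * (a.+1 + k) ^ a) =
  \sum_(j < a.+2) 'C(a.+1, j) * (k ^ j * (j * a.+1 ^ (a.+1 - j))).
Proof.
rewrite big_ord_recl mul0n !muln0 add0n expnDn !big_distrr.
apply: eq_bigr => i _; rewrite lift0 subSS expnS.
have := mul_bin_diag a.+1 i; rewrite /= => e.
transitivity (a.+1 * 'C(a, i) * (k * (a.+1 ^ (a - i) * k ^ i))); first by ring.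
by rewrite e; ring.
Qed.

Section Cayley.
Variable V : finType.
Implicit Types (p q : {ffun V -> V}) (A B S : {set V}) (x y : V).

(** Forests on [A] planted on [S], whose vertices act as the roots when [S] is disjoint from [A]. *)
Definition attached A S : {set {ffun V -> V}} :=
  [set p : {ffun V -> V} | [forall (x | x \notin A), p x == x] &&
           [forall x in A, exists s in S, fconnect p x s]].

Lemma attachedP A S p :
  reflect ((forall x, x \notin A -> p x = x) /\
           forall x, x \in A -> exists2 s, s \in S & fconnect p x s) (p \in attached A S).
Proof.
rewrite inE; apply: (iffP andP) => -[h1 h2]; split.
- by move=> x xA; have /implyP/(_ xA)/eqP := forallP h1 x.
- by move=> x xA; have /implyP/(_ xA)/exists_inP := forallP h2 x.
- by apply/forallP => x; apply/implyP => /h1 ->.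
- by apply/forallP => x; apply/implyP => xA; apply/exists_inP/h2.
Qed.

Definition maps_into B S : {set {ffun V -> V}} :=
  [set f : {ffun V -> V} | f \in family (fun x => [pred y | if x \in B then y \in S else y == x])].

Lemma card_maps_into B S : #|maps_into B S| = #|S| ^ #|B|.
Proof.
rewrite cardsE card_family foldrE big_map big_enum /= -prod_nat_const [RHS]big_mkcond /=.
apply: eq_bigr => x _; case: ifP => xB; last rewrite -(card1 x); apply: eq_card => y //;
  by rewrite unfold_in /= xB.
Qed.

Definition glue B (f q : {ffun V -> V}) : {ffun V -> V} :=
  [ffun x => if x \in B then f x else q x].

Definition first_level A S p : {set V} := [set x in A | p x \in S].

(** The vertices of [B] choose parents in [S] freely, and the rest of [A] carries any forest planted
    on [B]; gluing these choices is injective. *)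
Lemma attached_level A S B : [disjoint A & S] -> B \subset A ->
  #|S| ^ #|B| * #|attached (A :\: B) B|
  <= #|[set p in attached A S | first_level A S p == B]|.
Proof.
move=> dAS sBA; rewrite -card_maps_into -cardsX.
rewrite -(@card_in_imset _ _ (fun u : {ffun V -> V} * {ffun V -> V} => glue B u.1 u.2)).
  apply: subset_leq_card; apply/subsetP => _ /imsetP[[f q] /setXP[/= fB /attachedP[q1 q2]] ->].
  have fP x : x \in B -> f x \in S.
    by move: fB; rewrite inE => /familyP/(_ x) + xB; rewrite inE xB.
  set p := glue B f q; have pB x : x \in B -> p x = f x by rewrite ffunE => ->.
  have pN x : x \notin B -> p x = q x by rewrite ffunE => /negPf ->.
  have toS x : x \in B -> exists2 s, s \in S & fconnect p x s.
    move=> xB; exists (f x); first exact: fP.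
    by rewrite -pB // fconnect1.
  have memS x : x \in A -> x \notin S.
    by move=> xA; apply: contraTN dAS => xS; apply/pred0Pn; exists x; rewrite /= xA.
  have toB x s : s \in B -> fconnect q x s -> exists2 s', s' \in S & fconnect p x s'.
    move=> sB; move: x; apply: fconnect_ind; first exact: toS.
    move=> x; case: (boolP (x \in B)) => xB; first by move=> _; apply: toS.
    by case=> s' s'S h; exists s' => //; rewrite fconnect_eqVf pN // h orbT.
  rewrite inE; apply/andP; split.
    apply/attachedP; split=> [x xA|x xA].
      have xB : x \notin B by apply: contra xA => /(subsetP sBA).
      by rewrite pN // q1 // inE negb_and xA orbT.
    case: (boolP (x \in B)) => xB; first exact: toS.
    have [|s sB /toB] := q2 x; first by rewrite inE xB.
    exact.
  apply/eqP/setP => x; rewrite inE; case: (boolP (x \in B)) => xB.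
    by rewrite (subsetP sBA) // pB // fP.
  apply/negP => /andP[xA]; rewrite pN // => qS.
  have xAB : x \in A :\: B by rewrite inE xB.
  have qxA : q x \notin A by apply: contraL qS; exact: memS.
  have [s sB] := q2 x xAB; rewrite fconnect_eqVf => /orP[/eqP xs|]; first by rewrite xs sB in xB.
  move=> qs; have es : s = q x.
    by apply: (fconnect_fixed _ qs); apply: q1; rewrite inE negb_and qxA orbT.
  by rewrite -es (subsetP sBA) in qxA.
move=> [f q] [f' q'] /setXP[/= fB /attachedP[q1 _]] /setXP[/= fB' /attachedP[q1' _]] /ffunP e.
have out g x : g \in maps_into B S -> x \notin B -> g x = x.
  by rewrite inE => /familyP/(_ x) + xB; rewrite inE (negPf xB) => /eqP.
have outq x : x \in B -> x \notin A :\: B by move=> xB; rewrite inE xB.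
congr pair; apply/ffunP => x; have := e x; rewrite !ffunE; case: (boolP (x \in B)) => xB //.
  by rewrite (out f) // (out f').
by rewrite q1 ?q1' ?outq.
Qed.

(** The planted forests number [k * (a + k) ^ (a - 1)] for [a = #|A|] and [k = #|S|]; the extra
    factor [a + k] avoids a negative exponent at [a = 0]. Induction on [a], sorting by the set [B]
    of vertices attached directly to [S]. *)
Lemma card_attached A S : [disjoint A & S] ->
  #|S| * (#|A| + #|S|) ^ #|A| <= #|attached A S| * (#|A| + #|S|).
Proof.
move: {2}#|A| (leqnn #|A|) => n; elim: n A S => [|n IH] A S.
  rewrite leqn0 => /eqP A0 _; rewrite A0 expn0 muln1 add0n.
  rewrite leq_pmull //; apply/card_gt0P; exists [ffun x => x].
  move/eqP: A0; rewrite cards_eq0 => /eqP ->.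
  by apply/attachedP; split=> [x _|x]; rewrite ?ffunE ?in_set0.
move=> An dAS.
case: (posnP #|A|) => [A0|Apos]; first by apply: IH => //; rewrite A0.
case: (posnP #|S|) => [S0|Spos]; first by rewrite S0 mul0n.
set a := #|A| in An Apos *; set k := #|S| in Spos *.
suff : k * (a + k) ^ a.-1 <= #|attached A S|.
  move=> h; rewrite -{2}(prednK Apos) expnSr mulnA leq_mul2r h orbT //.
have -> : #|attached A S| = \sum_(B : {set V} | B \subset A)
     #|[set p in attached A S | first_level A S p == B]|.
  rewrite -sum1_card (partition_big (first_level A S) (fun B => B \subset A)) /=.
    by apply: eq_bigr => B _; rewrite sum1dep_card; apply: eq_card => p; rewrite !inE.
  by move=> p _; apply/subsetP => x; rewrite inE => /andP[].
rewrite -(leq_pmul2l Apos).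
apply: (@leq_trans (\sum_(B : {set V} | B \subset A) k ^ #|B| * (#|B| * a ^ (a - #|B|)))).
  have szB (B : {set V}) : B \subset A -> #|B| < a.+1.
    by move=> sBA; rewrite ltnS subset_leq_card.
  rewrite (partition_big (fun B : {set V} => inord #|B| : 'I_a.+1) xpredT) //=.
  apply: (@leq_trans (\sum_(j < a.+1) 'C(a, j) * (k ^ j * (j * a ^ (a - j))))).
    by rewrite -(prednK Apos) binomial_mean.
  apply: leq_sum => j _; rewrite -cards_draws -sum_nat_const.
  rewrite [X in X <= _](eq_bigl (fun B : {set V} => (B \subset A) && (inord #|B| == j))).
    apply: leq_sum => B /andP[sBA /eqP/(congr1 val)/=]; rewrite inordK ?szB // => <-.
    exact: leqnn.
  move=> B; rewrite inE; case: (boolP (B \subset A)) => //= sBA.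
  by rewrite -val_eqE /= inordK ?szB.
rewrite big_distrr /=; apply: leq_sum => B sBA.
apply: leq_trans (leq_mul (leqnn a) (attached_level dAS sBA)).
rewrite [X in _ <= X]mulnCA leq_mul2l; apply/orP; right.
have cAB : #|A :\: B| = a - #|B| by rewrite cardsD (setIidPr sBA).
have leBA : #|B| <= a by apply: subset_leq_card.
case: (posnP #|B|) => [->|Bpos]; first by rewrite mul0n.
(* The sizes of [A :\: B] and [B] add up to [a], so the induction hypothesis supplies exactly
   [#|B| * a ^ (a - #|B|)]. *)
have := IH (A :\: B) B; rewrite cAB subnK // => h; rewrite [a * _]mulnC; apply: h.
  by rewrite leq_subLR (leq_trans An) // addnC -addn1 leq_add2l.
by rewrite disjoints_subset setDE subsetIr.
Qed.

Lemma card_arbos (r0 : V) : #|V| ^ #|V|.-1 <= #|arbos r0| * #|V|.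
Proof.
have dj : [disjoint ~: [set r0] & [set r0]] by rewrite disjoints_subset.
have cV : #|~: [set r0]| + #|[set r0]| = #|V| by rewrite addnC cardsC.
have := card_attached dj; rewrite cV cards1 mul1n.
have -> : #|~: [set r0]| = #|V|.-1 by rewrite -cV cards1 addn1.
move=> h; apply: (leq_trans h); rewrite leq_mul2r; apply/orP; right.
apply: subset_leq_card; apply/subsetP => p /attachedP[h1 h2]; apply/arbosP; split.
  by apply: h1; rewrite !inE negbK eqxx.
move=> x; have [->|xr] := eqVneq x r0; first exact: connect0.
by have [|s /set1P ->] := h2 x; first by rewrite !inE.
Qed.

End Cayley.

(** * The table of small forest classes *)

(* Numbers are fixed-point with denominator [unitN].  [zN] exceeds 0.994541 / e,
   and [entry table k n] will bound the generating function of forests with [k]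
   roots and [n] ideals from above; [k <= 8] suffices since [n < 512 = 2 ^ 9]. *)
Definition unitN : N := 1000000000000%num.
Definition zN : N := 365872000001%num.

Definition sumN (s : seq N) : N := foldr N.add 0%num s.

Definition entry (T : seq (seq N)) (k n : nat) : N := nth 0%num (nth [::] T n) k.
Definition total (T : seq (seq N)) (n : nat) : N := sumN [seq entry T k n | k <- iota 0 9].

Definition conv (T : seq (seq N)) (k n : nat) (ds : seq nat) : N :=
  sumN [seq N.mul (total T d) (entry T k (n %/ d.+1)) | d <- ds].

(** A tree over a forest with [d] ideals has [d.+1] ideals, so divisors are indexed by their
    predecessors. *)
Definition divisors_pred n : seq nat := [seq d <- iota 0 n | d.+1 %| n].

(** The leading 0 reflects that a forest without roots has exactly one ideal; the added 1 rounds the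
    quotient up. *)
Definition next_row T n : seq N :=
  let ds := divisors_pred n in
  0%num :: [seq N.add 1 (N.div (N.mul zN (conv T k n ds))
               (N.mul (N.of_nat k.+1) (N.mul unitN unitN))) | k <- iota 0 8].

Fixpoint extend fuel T : seq (seq N) :=
  if fuel is f.+1 then extend f (rcons T (next_row T (size T))) else T.

Definition table : seq (seq N) :=
  Eval vm_compute in extend 510 [:: [::]; [:: unitN]].

(** The recurrence in cross-multiplied form, checked on the finished table: soundness rests on this
    test and not on how the table was produced. *)
Definition row_ok n : bool :=
  let ds := divisors_pred n in
  all (fun k => N.leb (N.mul zN (conv table k n ds))
     (N.mul (N.of_nat k.+1) (N.mul (entry table k.+1 n) (N.mul unitN unitN))))
    (iota 0 8).

Lemma table_ok : all row_ok (iota 1 511).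
Proof. by vm_compute. Qed.

(** Iterated integer square roots approximate the root of order [2 ^ n] from below; [root_hi] rounds
    up instead. *)
Fixpoint root_lo n (x : N) : N :=
  if n is m.+1 then root_lo m (N.sqrt (N.mul x unitN)) else x.

Fixpoint root_hi n (x : N) : N :=
  if n is m.+1 then root_hi m (N.succ (N.sqrt (N.mul x unitN))) else x.

Definition lo64 (n : nat) : N := root_lo 6 (N.mul (N.of_nat n) unitN).
Definition hi64 (n : nat) : N := root_hi 6 (N.mul (N.of_nat n) unitN).

(* The literal is just above [513 / 512]. *)
Definition wN : N := Eval vm_compute in root_hi 6 (1001953125001%num).

(** An upper bound for [phi d.+1 - w * phi d] at scale [unitN] squared. Truncated subtraction
    replaces a negative difference by 0, which remains an upper bound. *)
Definition excess d : N := N.sub (N.mul (hi64 d.+1) unitN) (N.mul wN (lo64 d)).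

Definition millionN : N := N.mul (N.of_nat 1000) (N.of_nat 1000).

(** The factors [zN], [total] and [excess] together carry [unitN] to the fourth power; the certified
    value of the finite sum is 0.005438. *)
Lemma excess_ok :
  N.leb (N.mul (N.mul millionN zN)
           (sumN [seq N.mul (total table d) (excess d) | d <- iota 0 512]))
        (N.mul (N.of_nat 5438) (N.mul (N.mul unitN unitN) (N.mul unitN unitN))).
Proof. by vm_compute. Qed.

Lemma wN_ok : N.leb (N.mul millionN wN) (N.mul (N.add millionN (N.of_nat 31)) unitN).
Proof. by vm_compute. Qed.

Local Open Scope ring_scope.

(** * Generating functions *)

Section PartialSums.
Variable R : realType.

(** The index pairs form a triangle inside the square. The term [m = 0] is empty, hence the shift
    from [M] to [M.+1] on the left. *)
Lemma sum_triangle_le (x y : nat -> R) M :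
  (forall i, 0 <= x i) -> (forall i, 0 <= y i) ->
  \sum_(m < M.+1) \sum_(j < m) x j * y (m.-1 - j)%N <=
  (\sum_(j < M) x j) * (\sum_(i < M) y i).
Proof.
move=> x0 y0.
have -> : \sum_(m < M.+1) \sum_(j < m) x j * y (m.-1 - j)%N =
    \sum_(j < M) x j * \sum_(i < M - j) y i.
  elim: M => [|M IH]; first by rewrite big_ord1 !big_ord0.
  rewrite big_ord_recr /= IH !big_ord_recr /= subnn subSnn big_ord1.
  rewrite addrA -big_split /=; congr (_ + _); apply: eq_bigr => j _.
  by rewrite subSn ?(ltnW (ltn_ord j)) // big_ord_recr /= mulrDr.
rewrite mulr_suml; apply: ler_sum => j _; apply: ler_wpM2l => //.
rewrite -!(big_mkord xpredT) (big_cat_nat _ (leq_subr j M)) //= lerDl.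
by apply: sumr_ge0.
Qed.

Lemma sum_expR_le (Y : R) Q : 0 <= Y -> \sum_(k < Q) Y ^+ k / k`!%:R <= expR Y.
Proof.
move=> Y0; rewrite /expR.
have -> : \sum_(k < Q) Y ^+ k / k`!%:R = series (exp_coeff Y) Q.
  by rewrite /series /= big_mkord.
apply: nondecreasing_cvgn_le; last exact: is_cvg_series_exp_coeff.
apply/nondecreasing_seqP => i; rewrite /series /= big_nat_recr //= lerDl.
by rewrite exp_coeff_ge0.
Qed.

End PartialSums.

(** * Truncated generating functions of forest classes *)

Section GeneratingFunction.
Variables (R : realType) (c : nat -> nat -> nat -> nat) (L Q : nat) (z : R).
Hypothesis c_zero : forall m N, (c m 0 N <= (m == 0) && (N == 1))%N.
Hypothesis c_N0 : forall m k, c m k 0 = 0%N.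
Hypothesis c_rec : forall m k N, (k.+1 * c m k.+1 N <=
  \sum_(j < m.+1) 'C(m, j) * (j * \sum_(d < L) \sum_(e < L) \sum_(k' < Q)
     (d.+1 * e == N) * (c j.-1 k' d * c (m - j) k e)))%N.
Hypothesis z_gt0 : 0 < z.

Definition egf_term m k N : R := (c m k N)%:R * z ^+ m / m`!%:R.
(** Truncation at [M] keeps every sum finite; bounds uniform in [M] take the place of
    convergence. *)
Definition egf M k N : R := \sum_(m < M) egf_term m k N.
Definition egfT M N : R := \sum_(k < Q) egf M k N.

Lemma egf_term_ge0 m k N : 0 <= egf_term m k N.
Proof. by rewrite /egf_term divr_ge0 ?mulr_ge0 ?exprn_ge0 ?ler0n // ltW. Qed.

Lemma egf_ge0 M k N : 0 <= egf M k N.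
Proof. by apply: sumr_ge0 => m _; exact: egf_term_ge0. Qed.

Lemma egfT_ge0 M N : 0 <= egfT M N.
Proof. by apply: sumr_ge0 => k _; exact: egf_ge0. Qed.

Lemma egf_le M k N : egf M k N <= egf M.+1 k N.
Proof. by rewrite /egf big_ord_recr /= lerDl egf_term_ge0. Qed.

Lemma egf_N0 M k : egf M k 0 = 0.
Proof. by apply: big1 => m _; rewrite /egf_term c_N0 !mul0r. Qed.

Lemma egfT_N0 M : egfT M 0 = 0.
Proof. by apply: big1 => k _; rewrite egf_N0. Qed.

Lemma egf_zero M N : egf M 0 N <= (N == 1%N)%:R.
Proof.
case: M => [|M]; first by rewrite /egf big_ord0 ler0n.
rewrite /egf big_ord_recl big1 ?addr0 => [|m _].
  rewrite /egf_term expr0 fact0 mulr1 divr1 ler_nat.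
  by have := c_zero 0 N.
rewrite /egf_term; have := c_zero (lift ord0 m) N.
by rewrite /= leqn0 => /eqP ->; rewrite !mul0r.
Qed.

(** The marked tree has [j + 1] vertices. Its root provides the factor [z], and the [j + 1] choices
    of that root reduce [(j + 1)!] to [j!]. *)
Lemma egf_term_rec m k N : k.+1%:R * egf_term m k.+1 N <=
  \sum_(j < m) \sum_(d < L) \sum_(e < L) \sum_(k' < Q)
     (d.+1 * e == N)%N%:R * z * (egf_term j k' d * egf_term (m.-1 - j) k e).
Proof.
rewrite /egf_term; set w := z ^+ m / m`!%:R.
have w0 : 0 <= w by rewrite divr_ge0 ?exprn_ge0 ?ler0n // ltW.
have -> : k.+1%:R * ((c m k.+1 N)%:R * z ^+ m / m`!%:R) = (k.+1 * c m k.+1 N)%:R * w.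
  by rewrite natrM /w !mulrA.
have h := c_rec m k N; rewrite -(ler_nat R) in h.
apply: (le_trans (ler_wpM2r w0 h)).
rewrite big_ord_recl mul0n muln0 add0n natr_sum mulr_suml.
apply: ler_sum => j _; rewrite lift0 /=.
rewrite !natrM natr_sum mulr_sumr mulr_sumr mulr_suml; apply: ler_sum => d _.
rewrite natr_sum mulr_sumr mulr_sumr mulr_suml; apply: ler_sum => e _.
rewrite natr_sum mulr_sumr mulr_sumr mulr_suml; apply: ler_sum => k' _.
rewrite !natrM.
have jm : (j < m)%N := ltn_ord j.
have -> : (m.-1 - j = m - j.+1)%N by lia.
have facm : (m`!%:R : R) = 'C(m, j.+1)%:R * (j.+1%:R * j`!%:R) * (m - j.+1)`!%:R.
  by rewrite -!natrM -factS -mulnA bin_fact.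
have zm : z ^+ m = z * z ^+ j * z ^+ (m - j.+1).
  by rewrite -exprS -exprD; congr (_ ^+ _); lia.
rewrite /w facm zm.
have f1 : (j`!%:R : R) != 0 by rewrite pnatr_eq0 -lt0n fact_gt0.
have f2 : ((m - j.+1)`!%:R : R) != 0 by rewrite pnatr_eq0 -lt0n fact_gt0.
have f3 : (j.+1%:R : R) != 0 by rewrite pnatr_eq0.
have f4 : ('C(m, j.+1)%:R : R) != 0 by rewrite pnatr_eq0 -lt0n bin_gt0.
move: (j`!%:R : R) f1 ((m - j.+1)`!%:R : R) f2 (j.+1%:R : R) f3 ('C(m, j.+1)%:R : R) f4.
move=> J1 f1 J2 f2 J3 f3 J4 f4.
rewrite le_eqVlt; apply/orP; left; apply/eqP; field.
by rewrite f1 f2 f3 f4.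
Qed.

(** The removed root uses up one vertex, so the right side involves only the lower truncation [M];
    this drives the inductions on [M]. *)
Lemma egf_rec M k N : k.+1%:R * egf M.+1 k.+1 N <=
  z * \sum_(d < L) \sum_(e < L) (d.+1 * e == N)%N%:R * (egfT M d * egf M k e).
Proof.
rewrite /egf mulr_sumr.
have step (m : 'I_M.+1) : true -> _ := fun _ => egf_term_rec m k N.
apply: (le_trans (ler_sum _ step)).
under eq_bigr => m _ do rewrite exchange_big /=.
rewrite exchange_big mulr_sumr /=; apply: ler_sum => d _.
under eq_bigr => m _ do rewrite exchange_big /=.
rewrite exchange_big mulr_sumr /=; apply: ler_sum => e _.
under eq_bigr => m _ do rewrite exchange_big /=.
rewrite exchange_big /= /egfT !mulr_suml !mulr_sumr; apply: ler_sum => k' _.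
under eq_bigr => m _ do rewrite -mulr_sumr.
rewrite -mulr_sumr mulrA [z * _]mulrC; apply: ler_wpM2l.
  by rewrite mulr_ge0 ?ler0n // ltW.
by apply: (@sum_triangle_le _ (fun i => egf_term i k' d) (fun i => egf_term i k e)) => i;
   exact: egf_term_ge0.
Qed.

(** * Sums against a completely multiplicative weight *)

Section Weighted.
Variable phi : nat -> R.
Hypothesis phi_ge0 : forall N, 0 <= phi N.
Hypothesis phiM : forall a b, phi (a * b)%N = phi a * phi b.
Hypothesis phi1 : phi 1 = 1.

Definition forest_gf M k := \sum_(N < L) egf M k N * phi N.
Definition tree_gf M := z * \sum_(d < L) egfT M d * phi d.+1.

Lemma tree_gf_ge0 M : 0 <= tree_gf M.
Proof. by rewrite mulr_ge0 ?(ltW z_gt0) ?sumr_ge0 // => d _; rewrite mulr_ge0 ?egfT_ge0. Qed.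

Lemma forest_gf_zero M : forest_gf M 0 <= 1.
Proof.
apply: (@le_trans _ _ (\sum_(N < L) (if N == 1%N :> nat then 1 else 0))).
  apply: ler_sum => N _; apply: (le_trans (ler_wpM2r (phi_ge0 N) (egf_zero M N))).
  by case: eqP => [->|_]; rewrite ?mul1r ?phi1 ?mul0r.
by rewrite -big_mkcond /= sumr_const lern1; apply/card_le1_eqP => i j /eqP ei /eqP ej; apply: val_inj; rewrite /= ei ej.
Qed.

(** Multiplicativity of [phi] turns the Dirichlet convolution into a product, since each pair
    [(d, e)] meets at most one [N < L]. *)
Lemma forest_gf_rec M k :
  k.+1%:R * forest_gf M.+1 k.+1 <= tree_gf M * forest_gf M k.
Proof.
rewrite /forest_gf mulr_sumr.
apply: (@le_trans _ _ (\sum_(N < L) (z * \sum_(d < L) \sum_(e < L)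
    (d.+1 * e == N)%N%:R * (egfT M d * egf M k e)) * phi N)).
  by apply: ler_sum => N _; rewrite mulrA ler_wpM2r // egf_rec.
under eq_bigr => N _ do rewrite -mulrA.
rewrite -mulr_sumr /tree_gf -mulrA; apply: ler_wpM2l; first exact: ltW.
under eq_bigr => N _ do rewrite mulr_suml.
rewrite exchange_big /= mulr_suml; apply: ler_sum => d _.
under eq_bigr => N _ do rewrite mulr_suml.
rewrite exchange_big /= mulr_sumr; apply: ler_sum => e _.
apply: (@le_trans _ _ (\sum_(N < L) (if (d.+1 * e)%N == N then
   egfT M d * phi d.+1 * (egf M k e * phi e) else 0))).
  apply: ler_sum => N _; case: eqP => [<-|_]; last by rewrite !mul0r.
  by rewrite phiM mul1r mulrACA.
rewrite -big_mkcond /= sumr_const -mulr_natr ler_piMr //.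
  by rewrite !mulr_ge0 ?egfT_ge0 ?egf_ge0.
rewrite lern1; apply/card_le1_eqP => i j /eqP ei /eqP ej.
by apply: val_inj; rewrite /= -ei -ej.
Qed.

Lemma forest_gf_le M k : forest_gf M k <= forest_gf M.+1 k.
Proof. by apply: ler_sum => N _; rewrite ler_wpM2r ?egf_le. Qed.

Lemma forest_gf_pow M k : forest_gf M.+1 k <= tree_gf M ^+ k / k`!%:R.
Proof.
elim: k => [|k IH]; first by rewrite expr0 fact0 divr1 forest_gf_zero.
have k0 : 0 < (k.+1%:R : R) by rewrite ltr0n.
rewrite -(ler_pM2l k0); apply: (le_trans (forest_gf_rec M k)).
have -> : k.+1%:R * (tree_gf M ^+ k.+1 / (k.+1)`!%:R) = tree_gf M * (tree_gf M ^+ k / k`!%:R).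
  have kf : (k`!%:R : R) != 0 by rewrite pnatr_eq0 -lt0n fact_gt0.
  have := lt0r_neq0 k0; rewrite factS natrM exprS; move: (k.+1%:R : R) => k1 k1n.
  by field; rewrite k1n kf.
by rewrite ler_wpM2l ?tree_gf_ge0 // (le_trans (forest_gf_le _ _)).
Qed.

Lemma forest_gf_sum M : \sum_(k < Q) forest_gf M.+1 k <= expR (tree_gf M).
Proof.
apply: le_trans (sum_expR_le Q (tree_gf_ge0 M)).
by apply: ler_sum => k _; exact: forest_gf_pow.
Qed.

Variables (K : nat) (w P y : R) (u : nat -> R).
Hypothesis w_ge0 : 0 <= w.
Hypothesis phi_growth : forall d, (K <= d)%N -> phi d.+1 <= w * phi d.
Hypothesis u_ge0 : forall d, 0 <= u d.
Hypothesis phi_u : forall d, (d < K)%N -> phi d.+1 <= w * phi d + u d.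
Hypothesis small_classes : forall M, z * \sum_(d < K) egfT M d * u d <= P.
Hypothesis y_ge0 : 0 <= y.
Hypothesis fixpoint : P + w * (z * expR y) <= y.

(** Each [phi d.+1] is replaced by [w * phi d], at the cost of a defect [u d] when [d < K]. The
    defects contribute at most [P], and the main terms form the forest sum bounded by the
    exponential. *)
Lemma tree_gf_rec M : tree_gf M.+1 <= P + w * (z * expR (tree_gf M)).
Proof.
rewrite [in X in _ <= X]mulrCA.
apply: (@le_trans _ _ (z * (\sum_(d < L) egfT M.+1 d * (if (d < K)%N then u d else 0)) +
    z * (w * \sum_(d < L) egfT M.+1 d * phi d))).
  rewrite -mulrDr /tree_gf; apply: ler_wpM2l; first exact: ltW.
  rewrite mulr_sumr -big_split /=; apply: ler_sum => d _.
  rewrite mulrCA -mulrDr; apply: ler_wpM2l; first exact: egfT_ge0.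
  by rewrite addrC; case: ltnP => [/phi_u|/phi_growth]; rewrite ?addr0.
apply: lerD.
  apply: le_trans (small_classes M.+1); apply: ler_wpM2l; first exact: ltW.
  rewrite (eq_bigr (fun d : 'I_L => if (d < K)%N then egfT M.+1 d * u d else 0)); last first.
    by move=> d _; case: ifP; rewrite ?mulr0.
  rewrite -(big_mkord xpredT (fun d => if (d < K)%N then egfT M.+1 d * u d else 0)).
  rewrite -(big_mkord xpredT (fun d => egfT M.+1 d * u d)).
  have nn d : 0 <= egfT M.+1 d * u d by rewrite mulr_ge0 ?egfT_ge0.
  apply: (@le_trans _ _ (\sum_(0 <= d < maxn K L) if (d < K)%N then egfT M.+1 d * u d else 0)).
    rewrite [X in _ <= X](big_cat_nat _ (leq_maxr K L)) //= lerDl sumr_ge0 // => d _.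
    by case: ifP.
  rewrite (big_cat_nat _ (leq_maxl K L)) //= [X in _ + X]big_nat [X in _ + X]big1 ?addr0.
    by apply: ler_sum_nat => d /andP[_ ->].
  by move=> d /andP[Kd _]; rewrite ltnNge Kd.
apply: ler_wpM2l; first exact: ltW.
apply: ler_wpM2l => //; apply: le_trans (forest_gf_sum M).
rewrite /forest_gf exchange_big /=; apply: ler_sum => d _.
by rewrite /egfT mulr_suml.
Qed.

(** The sum vanishes at [M = 0], and the increasing map sending [Y] to [P + w z e^Y] preserves the
    bound [y]. *)
Lemma tree_gf_bounded M : tree_gf M <= y.
Proof.
elim: M => [|M IH].
  rewrite /tree_gf big1 ?mulr0 // => d _.
  by rewrite /egfT big1 ?mul0r // => k _; rewrite /egf big_ord0.
apply: le_trans (tree_gf_rec M) (le_trans _ fixpoint).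
by rewrite lerD2l ler_wpM2l // ler_wpM2l ?(ltW z_gt0) // ler_expR.
Qed.

(** All terms are non-negative, so the single term of degree [m] is at most the whole truncated
    series. *)
Lemma forest_sum_bound m :
  \sum_(k < Q) \sum_(N < L) (c m k N)%:R * phi N <= m`!%:R / z ^+ m * expR y.
Proof.
have zm : 0 < z ^+ m / m`!%:R by rewrite divr_gt0 ?exprn_gt0 ?ltr0n ?fact_gt0.
rewrite -(ler_pM2l zm) [X in _ <= X]mulrA.
have -> : z ^+ m / m`!%:R * (m`!%:R / z ^+ m) = 1.
  rewrite mulrA divfK ?divff ?expf_neq0 ?gt_eqF //.
  by rewrite ltr0n fact_gt0.
rewrite mul1r; apply: le_trans (_ : expR (tree_gf m) <= _); last by rewrite ler_expR tree_gf_bounded.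
apply: le_trans (forest_gf_sum m); rewrite mulr_sumr; apply: ler_sum => k _.
rewrite mulr_sumr; apply: ler_sum => N _; rewrite mulrA ler_wpM2r //.
rewrite /egf big_ord_recr /= -[X in X <= _]add0r lerD ?egf_ge0 //.
by rewrite /egf_term mulrC mulrA.
Qed.

End Weighted.

Lemma divisor_pairs_le (X : nat -> nat -> R) N : (0 < N)%N ->
  (forall d e, 0 <= X d e) ->
  \sum_(d < L) \sum_(e < L) (d.+1 * e == N)%N%:R * X d e <=
  \sum_(d < N | (d.+1 %| N)%N) X d (N %/ d.+1)%N.
Proof.
move=> N0 X0; pose Y d : R := if (d.+1 %| N)%N then X d (N %/ d.+1)%N else 0.
have Y0 d : 0 <= Y d by rewrite /Y; case: ifP.
apply: (@le_trans _ _ (\sum_(d < L) Y d)).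
  apply: ler_sum => d _; rewrite /Y; case: ifPn => [/dvdnP[q Nq]|ndv].
    apply: (@le_trans _ _ (\sum_(e < L) (if (e : nat) == q then X d q else 0))).
      apply: ler_sum => e _; rewrite Nq mulnC eqn_pmul2r //.
      by case: eqP => [->|_]; rewrite ?mul1r ?mul0r.
    rewrite -big_mkcond /= sumr_const Nq mulnK // -mulr_natr ler_piMr // lern1.
    by apply/card_le1_eqP => i j /eqP ei /eqP ej; apply: val_inj; rewrite /= ei ej.
  rewrite big1 // => e _; case: eqP => [eN|_]; last by rewrite mul0r.
  by rewrite -eN dvdn_mulr in ndv.
rewrite [X in _ <= X]big_mkcond /= -(big_mkord xpredT Y).
rewrite -(big_mkord xpredT (fun d => if (d.+1 %| N)%N then X d (N %/ d.+1)%N else 0)).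
rewrite -/Y; apply: (@le_trans _ _ (\sum_(0 <= d < maxn N L) Y d)).
  by rewrite [X in _ <= X](big_cat_nat _ (leq_maxr N L)) //= lerDl sumr_ge0.
rewrite (big_cat_nat _ (leq_maxl N L)) //= [X in _ + X]big_nat [X in _ + X]big1 ?addr0 //.
move=> d /andP[Nd _]; rewrite /Y; case: ifP => // /(dvdn_leq N0).
by rewrite ltnNge Nd.
Qed.

Lemma egf_rec_div M k N : (0 < N)%N -> k.+1%:R * egf M.+1 k.+1 N <=
  z * \sum_(d < N | (d.+1 %| N)%N) egfT M d * egf M k (N %/ d.+1).
Proof.
move=> N0; apply: (le_trans (egf_rec M k N)); apply: ler_wpM2l; first exact: ltW.
apply: (@divisor_pairs_le (fun d e => egfT M d * egf M k e)) => // d e.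
by rewrite mulr_ge0 ?egfT_ge0 ?egf_ge0.
Qed.

(** Each tree at least doubles the number of ideals, so [k] roots force at least [2 ^ k] of them. In
    the recurrence the term [d = 0] vanishes, and every other divisor is at least 2. *)
Lemma egf_small M k N : (N < 2 ^ k)%N -> egf M k N = 0.
Proof.
elim: k M N => [|k IH] M N; first by rewrite expn0 ltnS leqn0 => /eqP ->; exact: egf_N0.
case: (posnP N) => [-> _|N0 Nk]; first exact: egf_N0.
case: M => [|M]; first by rewrite /egf big_ord0.
apply/eqP; rewrite eq_le egf_ge0 andbT.
have k0 : 0 < (k.+1%:R : R) by rewrite ltr0n.
rewrite -(ler_pM2l k0) mulr0; apply: (le_trans (egf_rec_div M k N0)).
rewrite big1 ?mulr0 // => -[[|d] dN] /= dv; first by rewrite egfT_N0 mul0r.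
rewrite IH ?mulr0 // ltn_divLR // (leq_trans Nk) // expnS mulnC leq_mul2l.
by rewrite orbT.
Qed.

(** * Comparison with a table of upper bounds *)

Section Table.
Variables (J : nat) (E : nat -> nat -> R).
Hypothesis E_ge0 : forall k N, 0 <= E k N.
Hypothesis E_init : 1 <= E 0 1.
Hypothesis E_rec : forall k N, (0 < N < 2 ^ J)%N -> (k.+1 < J)%N ->
  z * \sum_(d < N | (d.+1 %| N)%N) (\sum_(i < J) E i d) * E k (N %/ d.+1)
  <= k.+1%:R * E k.+1 N.

Lemma egfT_table_sum M N : (N < 2 ^ J)%N ->
  (forall k, (k < J)%N -> egf M k N <= E k N) -> egfT M N <= \sum_(k < J) E k N.
Proof.
move=> NK h; rewrite /egfT -(big_mkord xpredT (fun k => egf M k N)).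
apply: (@le_trans _ _ (\sum_(0 <= k < maxn J Q) egf M k N)).
  rewrite [X in _ <= X](big_cat_nat _ (leq_maxr J Q)) //= lerDl sumr_ge0 // => k _.
  exact: egf_ge0.
rewrite (big_cat_nat _ (leq_maxl J Q)) //= [X in _ + X]big_nat [X in _ + X]big1 ?addr0.
  by rewrite big_mkord; apply: ler_sum => k _; apply: h.
(* Forests with [J] or more roots have at least [2 ^ J] ideals and do not contribute to [N]. *)
move=> k /andP[Jk _]; apply: egf_small; apply: (leq_trans NK).
by rewrite leq_exp2l.
Qed.

(** Strong induction on [N]. The term [d = 0], the only one that refers back to [N] itself, vanishes
    because no forest has 0 ideals. *)
Lemma egf_table M k N : (N < 2 ^ J)%N -> (k < J)%N -> egf M k N <= E k N.
Proof.
elim/ltn_ind: N M k => N IH M [|k] NK kJ.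
  apply: (le_trans (egf_zero M N)); case: eqP => [->|_] //.
case: (posnP N) => [->|N0]; first by rewrite egf_N0.
case: M => [|M]; first by rewrite /egf big_ord0.
have k0 : 0 < (k.+1%:R : R) by rewrite ltr0n.
rewrite -(ler_pM2l k0); apply: (le_trans (egf_rec_div M k N0)).
apply: le_trans (E_rec _ _) => //; last by rewrite N0.
apply: ler_wpM2l; first exact: ltW.
apply: ler_sum => -[[|d] dN] /= dv.
  by rewrite egfT_N0 mul0r mulr_ge0 // sumr_ge0.
have qN : (N %/ d.+2 < N)%N by rewrite ltn_Pdiv.
apply: ler_pM; rewrite ?egfT_ge0 ?egf_ge0 //.
  by apply: egfT_table_sum => [|i iJ]; [apply: ltn_trans NK | apply: IH => //; apply: ltn_trans NK].
by apply: IH => //; [apply: ltn_trans NK | apply: ltnW].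
Qed.

Lemma egfT_table M N : (N < 2 ^ J)%N -> egfT M N <= \sum_(k < J) E k N.
Proof. by move=> NK; apply: egfT_table_sum => // k kJ; exact: egf_table. Qed.

End Table.

End GeneratingFunction.

(** * Numerical certificate *)

Section NumericBound.
Variable R : realType.

Fact vN_key : unit. Proof. exact: tt. Qed.

(* Locked: unification would otherwise unfold literals into unary numbers. *)
Definition vN (x : N) : R := locked_with vN_key (N.to_nat x)%:R.

Lemma vNE x : vN x = (N.to_nat x)%:R. Proof. by rewrite /vN unlock. Qed.

Lemma vN_ge0 x : 0 <= vN x. Proof. by rewrite vNE ler0n. Qed.

Lemma vN_add x y : vN (N.add x y) = vN x + vN y.
Proof. by rewrite !vNE N2Nat.inj_add natrD. Qed.

Lemma vN_mul x y : vN (N.mul x y) = vN x * vN y.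
Proof. by rewrite !vNE N2Nat.inj_mul natrM. Qed.

Lemma vN_le x y : N.le x y -> vN x <= vN y.
Proof. by move=> h; rewrite !vNE ler_nat; lia. Qed.

Lemma vN_leb x y : N.leb x y -> vN x <= vN y.
Proof. by move/N.leb_le/vN_le. Qed.

Lemma vN_sub x y : vN x <= vN y + vN (N.sub x y).
Proof. by rewrite -vN_add; apply: vN_le; lia. Qed.

Lemma vN_of_nat n : vN (N.of_nat n) = n%:R.
Proof. by rewrite vNE Nat2N.id. Qed.

Lemma vN_sum s : vN (sumN s) = \sum_(x <- s) vN x.
Proof.
by elim: s => [|x s IH] /=; [rewrite big_nil vNE | rewrite big_cons vN_add IH].
Qed.

Lemma vN_pos (p : positive) : 0 < vN (N.pos p).
Proof. by rewrite vNE ltr0n; lia. Qed.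

Definition scaled (x : N) : R := vN x / vN unitN.

Lemma unit_gt0 : 0 < vN unitN. Proof. exact: vN_pos. Qed.

Lemma scaled_ge0 x : 0 <= scaled x.
Proof. by rewrite divr_ge0 ?vN_ge0. Qed.

Lemma root_lo_spec n x : scaled (root_lo n x) ^+ (2 ^ n) <= scaled x.
Proof.
elim: n x => [|n IH] x /=; first by rewrite expn0 expr1.
set y := N.sqrt _; have := IH y; rewrite expnS mulnC exprM => h.
apply: (@le_trans _ _ (scaled y ^+ 2)).
  by rewrite lerXn2r ?nnegrE ?exprn_ge0 ?scaled_ge0.
rewrite /scaled expr_div_n ler_pdivrMr ?exprn_gt0 ?unit_gt0 //.
rewrite expr2 -vN_mul expr2 mulrA divfK ?gt_eqF ?unit_gt0 // -vN_mul.
by apply: vN_le; have [] := N.sqrt_spec' (N.mul x unitN).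
Qed.

Lemma root_hi_spec n x : scaled x <= scaled (root_hi n x) ^+ (2 ^ n).
Proof.
elim: n x => [|n IH] x /=; first by rewrite expn0 expr1.
set y := N.succ _; have := IH y; rewrite expnS mulnC exprM => h.
apply: (@le_trans _ _ (scaled y ^+ 2)); last first.
  by rewrite lerXn2r ?nnegrE ?exprn_ge0 ?scaled_ge0.
rewrite /scaled expr_div_n ler_pdivlMr ?exprn_gt0 ?unit_gt0 //.
rewrite expr2 mulrA divfK ?gt_eqF ?unit_gt0 // -vN_mul expr2 -vN_mul.
by apply: vN_le; have [_ h2] := N.sqrt_spec' (N.mul x unitN); apply: N.lt_le_incl.
Qed.

Definition root64 (x : R) : R := x `^ 64^-1.

Lemma root64K (x : R) : 0 <= x -> root64 (x ^+ 64) = x.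
Proof.
move=> x0; rewrite /root64 -powR_mulrn // -powRrM divff ?powRr1 //.
by rewrite pnatr_eq0.
Qed.

Lemma root64_le (x y : R) : 0 <= x -> 0 <= y -> x <= y ^+ 64 -> root64 x <= y.
Proof.
move=> x0 y0 h; rewrite -[X in _ <= X]root64K //; by apply: ge0_ler_powR; rewrite ?invr_ge0 ?nnegrE ?exprn_ge0.
Qed.

Lemma root64_ge (x y : R) : 0 <= x -> 0 <= y -> y ^+ 64 <= x -> y <= root64 x.
Proof.
move=> x0 y0 h; rewrite -[X in X <= _]root64K //; by apply: ge0_ler_powR; rewrite ?invr_ge0 ?nnegrE ?exprn_ge0.
Qed.

Definition phi (n : nat) : R := root64 n%:R.

Lemma phi_ge0 n : 0 <= phi n. Proof. exact: powR_ge0. Qed.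

Lemma phiM a b : phi (a * b) = phi a * phi b.
Proof. by rewrite /phi natrM /root64 powRM. Qed.

Lemma phi1 : phi 1 = 1. Proof. by rewrite /phi /root64 powR1. Qed.

Lemma phi_lo d : scaled (lo64 d) <= phi d.
Proof.
apply: root64_ge; rewrite ?scaled_ge0 //.
apply: le_trans (root_lo_spec 6 _) _.
by rewrite /scaled vN_mul vN_of_nat mulfK ?gt_eqF ?unit_gt0.
Qed.

Lemma phi_hi d : phi d <= scaled (hi64 d).
Proof.
apply: root64_le; rewrite ?scaled_ge0 //.
apply: le_trans _ (root_hi_spec 6 _).
by rewrite /scaled vN_mul vN_of_nat mulfK ?gt_eqF ?unit_gt0.
Qed.

Lemma phi_growth d : (512 <= d)%N -> phi d.+1 <= scaled wN * phi d.
Proof.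
move=> d512.
have hw : 1 + 512^-1 <= scaled wN ^+ 64.
  apply: le_trans _ (root_hi_spec 6 1001953125001%num).
  rewrite /scaled ler_pdivlMr ?unit_gt0 //.
  have := @vN_leb (N.mul (N.of_nat 513) unitN) (N.mul (N.of_nat 512) 1001953125001%num) isT.
  rewrite !vN_mul !vN_of_nat; move: (vN _) (vN unitN) => b a h; lra.
have d0 : 0 < (d%:R : R) by rewrite ltr0n; lia.
have s0 : 0 <= scaled wN ^+ 64 := exprn_ge0 _ (scaled_ge0 _).
rewrite -[scaled wN]root64K ?scaled_ge0 // /phi /root64 -powRM //.
apply: ge0_ler_powR; rewrite ?invr_ge0 ?nnegrE //; first exact: mulr_ge0.
apply: (@le_trans _ _ ((1 + 512^-1) * d%:R)); last by apply: ler_wpM2r => //; exact: ltW.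
have d512R : 512 <= (d%:R : R) by rewrite ler_nat.
by rewrite -natr1; move: (d%:R : R) d512R => x hx; lra.
Qed.

Definition E_tab k n : R := scaled (entry table k n).
Definition u_tab d : R := vN (excess d) / (vN unitN * vN unitN).

Lemma E_tab_init : 1 <= E_tab 0 1.
Proof.
have U0 : vN unitN != 0 by rewrite gt_eqF ?unit_gt0.
have -> : E_tab 0 1 = vN unitN / vN unitN by [].
by rewrite (divff U0).
Qed.

Lemma phi_u d : (d < 512)%N -> phi d.+1 <= scaled wN * phi d + u_tab d.
Proof.
move=> _; apply: (le_trans (phi_hi d.+1)).
apply: (@le_trans _ _ (scaled wN * scaled (lo64 d) + u_tab d)); last first.
  by rewrite lerD2r ler_wpM2l ?scaled_ge0 ?phi_lo.
have U0 := unit_gt0; have := vN_sub (N.mul (hi64 d.+1) unitN) (N.mul wN (lo64 d)).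
rewrite -/(excess d) !vN_mul /scaled /u_tab; set U := vN unitN in U0 *.
move: (vN _) (vN _) (vN _) (vN _) => a b c e h.
rewrite mulf_div -mulrDl ler_pdivlMr ?mulr_gt0 // mulrA divfK ?gt_eqF //.
Qed.

Lemma total_tab n : scaled (total table n) = \sum_(k < 9) E_tab k n.
Proof.
rewrite /scaled vN_sum big_map -(big_mkord xpredT (E_tab^~ n)).
by rewrite /index_iota subn0 mulr_suml.
Qed.

Variable z : R.
Hypothesis z_le : z <= scaled zN.

Lemma E_tab_rec k n : (0 < n < 2 ^ 9)%N -> (k.+1 < 9)%N ->
  z * \sum_(d < n | (d.+1 %| n)%N) (\sum_(i < 9) E_tab i d) * E_tab k (n %/ d.+1)
  <= k.+1%:R * E_tab k.+1 n.
Proof.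
move=> /andP[n0 nK] kJ; have U0 := unit_gt0.
have nI : n \in iota 1 511 by rewrite mem_iota n0.
have kI : k \in iota 0 8 by rewrite mem_iota.
have := vN_leb (allP (allP table_ok n nI) k kI).
rewrite !vN_mul vN_of_nat vN_sum big_map big_filter.
rewrite (eq_bigr (fun d => vN (total table d) * vN (entry table k (n %/ d.+1)))); last first.
  by move=> d _; rewrite vN_mul.
rewrite (_ : iota 0 n = index_iota 0 n) ?big_mkord => [h|]; last by rewrite /index_iota subn0.
under eq_bigr => d _ do rewrite -total_tab.
apply: (@le_trans _ _ (scaled zN * \sum_(d < n | (d.+1 %| n)%N)
   scaled (total table d) * E_tab k (n %/ d.+1))).
  apply: ler_wpM2r => //; apply: sumr_ge0 => d _.
  by rewrite mulr_ge0 ?scaled_ge0.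
under eq_bigr => d _ do rewrite /E_tab /scaled mulf_div.
rewrite -mulr_suml /E_tab /scaled mulf_div ler_pdivrMr ?mulr_gt0 //.
apply: (le_trans h); rewrite le_eqVlt; apply/orP; left; apply/eqP.
by field; rewrite gt_eqF.
Qed.

(** Arbitrary sequences [t] and [x] keep the concrete table out of the arithmetic. *)
Lemma sum_check (t x : nat -> N) n :
  N.leb (N.mul (N.mul millionN zN) (sumN [seq N.mul (t d) (x d) | d <- iota 0 n]))
    (N.mul (N.of_nat 5438) (N.mul (N.mul unitN unitN) (N.mul unitN unitN))) ->
  scaled zN * \sum_(d < n) scaled (t d) * (vN (x d) / (vN unitN * vN unitN))
  <= 5438 / 1000 / 1000.
Proof.
have U0 := unit_gt0; move/vN_leb.
rewrite !vN_mul !vN_of_nat vN_sum big_map.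
rewrite (eq_bigr (fun d => vN (t d) * vN (x d))); last by move=> d _; rewrite vN_mul.
rewrite (_ : iota 0 n = index_iota 0 n) ?big_mkord => [h|]; last by rewrite /index_iota subn0.
under eq_bigr => d _ do rewrite /scaled mulf_div.
rewrite -mulr_suml /scaled mulf_div ler_pdivrMr ?mulr_gt0 //.
move: h; move: (\sum_(i < n) _) => S h.
by move: (vN zN) (vN unitN) h {U0} => Z U h; lra.
Qed.

Lemma small_classes_tab :
  z * \sum_(d < 512) (\sum_(k < 9) E_tab k d) * u_tab d <= 5438 / 1000 / 1000.
Proof.
apply: le_trans (sum_check excess_ok); under eq_bigr => d _ do rewrite -total_tab.
apply: ler_wpM2r => //; apply: sumr_ge0 => d _.
by apply: mulr_ge0; [exact: scaled_ge0 | apply: divr_ge0; rewrite ?mulr_ge0 ?vN_ge0].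
Qed.

End NumericBound.

(** * Explicit real constants *)

Section Constants.
Variable R : realType.

(* Ring numerals are unary, hence the decimals in groups of two digits. *)
Definition theta : R := 99 / 100 + 45 / 100 / 100 + 41 / 100 / 100 / 100.
Definition zcrit : R := theta / expR 1.
(* Near-optimal for [P + w theta e^(y-1) <= y]. *)
Definition ycrit : R := 1 + (54 / 100 / 100 + 4 / 10 / 100 / 100).

Lemma theta_gt0 : 0 < theta. Proof. rewrite /theta; lra. Qed.

Lemma zcrit_gt0 : 0 < zcrit.
Proof. by rewrite divr_gt0 ?theta_gt0 ?expR_gt0. Qed.

Lemma expR1_ge : 2 + 71 / 100 + 82 / 100 / 100 + 76 / 100 / 100 / 100 <= expR 1 :> R.
Proof.
apply: le_trans (sum_expR_le 9 (ler01 : 0 <= 1 :> R)).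
rewrite !big_ord_recr big_ord0 /= !expr1n !factS fact0 !muln1 /=.
lra.
Qed.

Lemma scaled_zN : 36 / 100 + 58 / 100 / 100 + 72 / 100 / 100 / 100 <= scaled R zN.
Proof.
rewrite /scaled ler_pdivlMr ?unit_gt0 //.
have := @vN_leb R (N.mul (N.add (N.mul (N.of_nat 3658) (N.of_nat 100)) (N.of_nat 72)) unitN)
  (N.mul millionN zN) isT.
rewrite !vN_mul vN_add vN_mul !vN_of_nat; move: (vN _ zN) (vN _ unitN) => a b h; lra.
Qed.

Lemma zcrit_le : zcrit <= scaled R zN.
Proof.
apply: le_trans scaled_zN; rewrite /zcrit ler_pdivrMr ?expR_gt0 //.
have := expR1_ge; rewrite /theta; move: (expR 1) => e h; lra.
Qed.

Lemma sqr_le (a b x : R) : 0 <= a -> a <= x -> b <= a * a -> b <= x ^+ 2.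
Proof.
move=> a0 ax bb; apply: (le_trans bb); rewrite -expr2.
by rewrite lerXn2r ?nnegrE // (le_trans a0).
Qed.

(** Here [zcrit * expR ycrit] is [theta * e^0.00544]. The needed lower bound on [e^(-0.00544)] comes
    from [1 - t <= e^(-t)] at [t = 0.00034], squared four times with decimals rounded down. *)
Lemma critical_fixpoint :
  5438 / 1000 / 1000 + scaled R wN * (zcrit * expR ycrit) <= ycrit.
Proof.
have w_le : scaled R wN <= 1 + 31 / 100 / 100 / 100.
  rewrite /scaled ler_pdivrMr ?unit_gt0 //; have := vN_leb R wN_ok.
  rewrite !vN_mul vN_add vN_mul !vN_of_nat; move: (vN _ wN) (vN _ unitN) => a b h; lra.
pose t : R := (3 / 100 / 100 + 4 / 10 / 100 / 100).
pose f : R := expR (- t).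
have fE : f ^+ 16 = expR (- ((54 / 100 / 100 + 4 / 10 / 100 / 100))).
  by rewrite -expRM_natl; congr expR; rewrite /t; lra.
have h1 : 1 - (3 / 100 / 100 + 4 / 10 / 100 / 100) <= f ^+ 1 by exact: expR_ge1Dx.
have h2 : (99 / 100 + 93 / 100 / 100 + 20 / 100 / 100 / 100 + 11 / 100 / 100 / 100 / 100) <= f ^+ 2.
  rewrite (_ : f ^+ 2 = (f ^+ 1) ^+ 2); last by rewrite -exprM.
  by apply: (@sqr_le (1 - (3 / 100 / 100 + 4 / 10 / 100 / 100))); [clear; lra | exact: h1 | clear; lra].
have h4 : (99 / 100 + 86 / 100 / 100 + 40 / 100 / 100 / 100 + 68 / 100 / 100 / 100 / 100) <= f ^+ 4.
  rewrite (_ : f ^+ 4 = (f ^+ 2) ^+ 2); last by rewrite -exprM.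
  by apply: (@sqr_le (99 / 100 + 93 / 100 / 100 + 20 / 100 / 100 / 100 + 11 / 100 / 100 / 100 / 100)); [clear; lra | exact: h2 | clear; lra].
have h8 : (99 / 100 + 72 / 100 / 100 + 83 / 100 / 100 / 100 + 20 / 100 / 100 / 100 / 100) <= f ^+ 8.
  rewrite (_ : f ^+ 8 = (f ^+ 4) ^+ 2); last by rewrite -exprM.
  by apply: (@sqr_le (99 / 100 + 86 / 100 / 100 + 40 / 100 / 100 / 100 + 68 / 100 / 100 / 100 / 100)); [clear; lra | exact: h4 | clear; lra].
have h16 : (99 / 100 + 45 / 100 / 100 + 73 / 100 / 100 / 100 + 78 / 100 / 100 / 100 / 100) <= f ^+ 16.
  rewrite (_ : f ^+ 16 = (f ^+ 8) ^+ 2); last by rewrite -exprM.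
  by apply: (@sqr_le (99 / 100 + 72 / 100 / 100 + 83 / 100 / 100 / 100 + 20 / 100 / 100 / 100 / 100)); [clear; lra | exact: h8 | clear; lra].
have hE : zcrit * expR ycrit * f ^+ 16 = theta.
  rewrite fE /ycrit expRD expRN /zcrit.
  move: (expR_gt0 (1 : R)) (expR_gt0 ((54 / 100 / 100 + 4 / 10 / 100 / 100) : R)).
  move: (expR _) (expR 1) => e2 e1 e10 e20.
  by field; rewrite !gt_eqF.
have ze0 : 0 <= zcrit * expR ycrit by rewrite mulr_ge0 ?expR_ge0 ?ltW ?zcrit_gt0.
move: ze0 hE h16; rewrite /theta; move: (f ^+ 16) (zcrit * _) => F ze ze0 hE hF.
have b1 : scaled R wN * ze <= (1 + 31 / 100 / 100 / 100) * ze by rewrite ler_wpM2r.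
have b2 : ze * (99 / 100 + 45 / 100 / 100 + 73 / 100 / 100 / 100 + 78 / 100 / 100 / 100 / 100) <= ze * F by rewrite ler_wpM2l.
rewrite /ycrit; move: (scaled R wN * ze) (ze * F) b1 b2 hE => x1 x2 b1 b2 hE.
by clear -b1 b2 hE; lra.
Qed.

(** Six squarings of [theta], rounded down at each stage, give about 0.704453; its product with
    1.4196 exceeds 1 by about 0.00004. *)
Lemma theta_root : 1 < theta ^+ 64 * (141960%:R / 100000%:R).
Proof.
have h1 : theta <= theta ^+ 1 by [].
have h2 : (98 / 100 + 91 / 100 / 100 + 11 / 100 / 100 / 100 + 80 / 100 / 100 / 100 / 100) <= theta ^+ 2.
  rewrite (_ : theta ^+ 2 = (theta ^+ 1) ^+ 2); last by rewrite -exprM.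
  by apply: (@sqr_le theta); [rewrite /theta; clear; lra | exact: h1 | rewrite /theta; clear; lra].
have h4 : (97 / 100 + 83 / 100 / 100 + 42 / 100 / 100 / 100 + 15 / 100 / 100 / 100 / 100) <= theta ^+ 4.
  rewrite (_ : theta ^+ 4 = (theta ^+ 2) ^+ 2); last by rewrite -exprM.
  by apply: (@sqr_le (98 / 100 + 91 / 100 / 100 + 11 / 100 / 100 / 100 + 80 / 100 / 100 / 100 / 100)); [clear; lra | exact: h2 | clear; lra].
have h8 : (95 / 100 + 71 / 100 / 100 + 53 / 100 / 100 / 100 + 36 / 100 / 100 / 100 / 100) <= theta ^+ 8.
  rewrite (_ : theta ^+ 8 = (theta ^+ 4) ^+ 2); last by rewrite -exprM.
  by apply: (@sqr_le (97 / 100 + 83 / 100 / 100 + 42 / 100 / 100 / 100 + 15 / 100 / 100 / 100 / 100)); [clear; lra | exact: h4 | clear; lra].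
have h16 : (91 / 100 + 61 / 100 / 100 + 42 / 100 / 100 / 100 + 55 / 100 / 100 / 100 / 100) <= theta ^+ 16.
  rewrite (_ : theta ^+ 16 = (theta ^+ 8) ^+ 2); last by rewrite -exprM.
  by apply: (@sqr_le (95 / 100 + 71 / 100 / 100 + 53 / 100 / 100 / 100 + 36 / 100 / 100 / 100 / 100)); [clear; lra | exact: h8 | clear; lra].
have h32 : (83 / 100 + 93 / 100 / 100 + 17 / 100 / 100 / 100 + 17 / 100 / 100 / 100 / 100) <= theta ^+ 32.
  rewrite (_ : theta ^+ 32 = (theta ^+ 16) ^+ 2); last by rewrite -exprM.
  by apply: (@sqr_le (91 / 100 + 61 / 100 / 100 + 42 / 100 / 100 / 100 + 55 / 100 / 100 / 100 / 100)); [clear; lra | exact: h16 | clear; lra].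
have h64 : (70 / 100 + 44 / 100 / 100 + 53 / 100 / 100 / 100 + 31 / 100 / 100 / 100 / 100) <= theta ^+ 64.
  rewrite (_ : theta ^+ 64 = (theta ^+ 32) ^+ 2); last by rewrite -exprM.
  by apply: (@sqr_le (83 / 100 + 93 / 100 / 100 + 17 / 100 / 100 / 100 + 17 / 100 / 100 / 100 / 100)); [clear; lra | exact: h32 | clear; lra].
have -> : 141960%:R / 100000%:R = 1419 / 1000 + 6 / 1000 / 10 :> R by clear; lra.
by move: h64; clear; move: (theta ^+ 64) => x hx; lra.
Qed.

End Constants.

Lemma forest_weight_bound (R : realType) (V : finType) (A : {set V}) :
  \sum_(p in forests A) phi R #|ideals A p| <=
  (#|A|)`!%:R / zcrit R ^+ #|A| * expR (ycrit R).
Proof.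
apply: (le_trans (sum_forests_leq A (phi_ge0 R))).
have z0 := zcrit_gt0 R; have zle := zcrit_le R.
apply: (@forest_sum_bound R (@fcount V) _ _ _ (@fcount_0_leq V) (@fcount_rec V) z0
  (phi R) (phi_ge0 R) (phiM R) (phi1 R) 512 (scaled R wN) (5438 / 1000 / 1000) _ (u_tab R)).
- exact: scaled_ge0.
- exact: phi_growth.
- by move=> d; rewrite divr_ge0 ?mulr_ge0 ?vN_ge0.
- exact: phi_u.
- move=> M; apply: le_trans (small_classes_tab zle).
  apply: ler_wpM2l; first exact: ltW.
  apply: ler_sum => d _; apply: ler_wpM2r; first by rewrite divr_ge0 ?mulr_ge0 ?vN_ge0.
  apply: (@egfT_table _ _ _ _ _ (@fcount_0_leq V) (@fcount_N0 V) (@fcount_rec V) z0 9 (E_tab R)).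
  + by move=> k n; exact: scaled_ge0.
  + exact: E_tab_init.
  + exact: E_tab_rec.
  + exact: ltn_ord.
- rewrite /ycrit; lra.
- exact: critical_fixpoint.
Qed.

(** * The probability estimate *)

Section Concentration.
Variable R : realType.

(** A weak Stirling bound by induction: raising [1 - 1/(n+2) <= e^(-1/(n+2))] to the power [n + 2]
    gives the step. *)
Lemma fact_exp_le n : n`!%:R * expR 1 ^+ n <= n.+1%:R ^+ n.+1 :> R.
Proof.
elim: n => [|n IH]; first by rewrite fact0 expr0 mulr1 expr1.
have e0 : 0 < expR 1 :> R := expR_gt0 _.
have step : n.+1%:R ^+ n.+2 * expR 1 <= n.+2%:R ^+ n.+2 :> R.
  have h : n.+1%:R / n.+2%:R <= expR (- (n.+2%:R)^-1) :> R.
    apply: le_trans (expR_ge1Dx _); rewrite ler_pdivrMr ?ltr0n // mulrDl mul1r.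
    by rewrite mulNr mulVf ?pnatr_eq0 // -(natr1 n.+1) addrK.
  have h2 : (n.+1%:R / n.+2%:R) ^+ n.+2 <= (expR 1)^-1 :> R.
    rewrite -expRN (_ : -1 = n.+2%:R * - (n.+2%:R)^-1) ?expRM_natl; last first.
      by rewrite mulrN mulfV ?pnatr_eq0.
    by rewrite lerXn2r ?nnegrE ?divr_ge0 ?expR_ge0.
  move: h2; rewrite expr_div_n ler_pdivrMr ?exprn_gt0 ?ltr0n //.
  by rewrite mulrC ler_pdivlMr.
apply: le_trans step; rewrite factS natrM (exprS (expR 1)) mulrACA.
by rewrite (exprS n.+1%:R) [X in _ <= X]mulrAC ler_pM2l // mulr_gt0 ?ltr0n.
Qed.

Definition base : R := 141960%:R / 100000%:R.
Definition xi : R := root64 base.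

Lemma base_gt0 : 0 < base. Proof. by rewrite /base divr_gt0 ?ltr0n. Qed.
Lemma xi_gt0 : 0 < xi. Proof. by rewrite powR_gt0 ?base_gt0. Qed.

Lemma xi64 : xi ^+ 64 = base.
Proof.
rewrite /xi /root64 -powR_mulrn ?powR_ge0 // -powRrM mulVf ?powRr1 ?(ltW base_gt0) //.
by rewrite pnatr_eq0.
Qed.

Lemma theta_xi_gt1 : 1 < theta R * xi.
Proof.
have tx0 : 0 <= theta R * xi by rewrite mulr_ge0 ?ltW ?theta_gt0 ?xi_gt0.
rewrite ltNge; apply/negP => h; have := theta_root R; rewrite -/base -xi64 -exprMn.
by rewrite ltNge exprn_ile1.
Qed.

Lemma root64_exp n : root64 (base ^+ n) = xi ^+ n.
Proof.
rewrite /root64 -powR_mulrn ?(ltW base_gt0) // -powRrM mulrC powRrM.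
by rewrite powR_mulrn ?powR_ge0.
Qed.

Lemma root64_ler (x y : R) : 0 <= x -> x <= y -> root64 x <= root64 y.
Proof.
move=> x0 xy; apply: ge0_ler_powR; rewrite ?invr_ge0 ?nnegrE //.
exact: le_trans xy.
Qed.

Lemma phi_le n : phi R n.+1 <= n.+1%:R.
Proof. by rewrite root64_le ?ler0n // ler_eXnr ?ler1n. Qed.

Definition rate : R := ln (theta R * xi).

Lemma rate_gt0 : 0 < rate.
Proof. by rewrite ln_gt0 // theta_xi_gt1. Qed.

(** The factor 48 is 2 from [2 * n.+1] times the [4! = 24] of the quartic bound on the
    exponential. *)
Definition tail_const : R := 48 * theta R * expR (ycrit R) / rate ^+ 4.

Section FixedSize.
Variable n : nat.
Let V : finType := 'I_n.+1.
Let r0 : V := ord0.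

(** Since [I >= 1], [I.+1 <= 2 * I]. The crude estimate of [phi] by the identity on the factor
    [2 * n.+1] costs only a polynomial factor. *)
Lemma arbo_subtree_phi (p : {ffun V -> V}) : p \in arbos r0 ->
  phi R (nb_subtrees (edges r0 p)) <=
  (2 * n.+1)%:R * phi R #|ideals (setT :\ r0) (cut setT r0 p)|.
Proof.
move=> ap; set I := #|ideals _ _|.
apply: (@le_trans _ _ (phi R ((2 * n.+1) * I))).
  apply: root64_ler; rewrite ?ler0n // ler_nat.
  apply: (leq_trans (nb_subtrees_leq ap)); rewrite (arbo_ideals ap) -/I card_ord.
  have : (0 < I)%N := card_ideals_gt0 _ _.
  by nia.
by rewrite phiM ler_wpM2r ?phi_ge0 // mul2n doubleS phi_le.
Qed.

(** Removing the root embeds the arborescences into the forests on the other [n] vertices. *)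
Lemma arbo_phi_sum :
  \sum_(p in arbos r0) phi R (nb_subtrees (edges r0 p)) <=
  (2 * n.+1)%:R * (n`!%:R / zcrit R ^+ n * expR (ycrit R)).
Proof.
apply: (le_trans (ler_sum _ (fun p ap => arbo_subtree_phi ap))).
rewrite -mulr_sumr; apply: ler_wpM2l; first exact: ler0n.
have cA : #|[set: V] :\ r0| = n.
  by have := cardsD1 r0 [set: V]; rewrite in_setT cardsT card_ord => -[].
have := forest_weight_bound R ([set: V] :\ r0); rewrite cA => h.
apply: le_trans h.
rewrite -(big_imset (fun q => phi R #|ideals (setT :\ r0) q|) (@arbo_cut_inj V r0)) /=.
rewrite [X in _ <= X](big_setID (cut setT r0 @: arbos r0)) /=.
rewrite (setIidPr _) ?lerDl ?sumr_ge0 // => [q _|]; first exact: phi_ge0.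
by apply/subsetP => _ /imsetP[p ap ->]; exact: arbo_cut_forest.
Qed.

(** Markov's inequality for the moment of order 1/64. *)
Lemma bad_arbos :
  #|[set p in arbos r0 | ~~ ((nb_subtrees (edges r0 p))%:R <= base ^+ n.+1)]|%:R * xi ^+ n.+1
  <= (2 * n.+1)%:R * (n`!%:R / zcrit R ^+ n * expR (ycrit R)).
Proof.
apply: le_trans arbo_phi_sum.
rewrite [X in _ <= X](bigID (fun p => (nb_subtrees (edges r0 p))%:R <= base ^+ n.+1)) /=.
rewrite -[X in X <= _]add0r lerD ?sumr_ge0 //; first by move=> p _; exact: phi_ge0.
rewrite mulr_natl -sumr_const big_mkcond [X in _ <= X]big_mkcond /=.
apply: ler_sum => p _; rewrite inE; case: ifP => // /andP[_ h].
rewrite -root64_exp; apply: root64_ler; first by rewrite exprn_ge0 ?(ltW base_gt0).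
by rewrite ltW // ltNge.
Qed.

Lemma bad_trees (P : pred {set {set V}}) :
  (#|[set E in labelled_trees n.+1 | P E]| <= #|[set p in arbos r0 | P (edges r0 p)]|)%N.
Proof.
apply: leq_trans (leq_imset_card (edges r0) _); apply: subset_leq_card.
apply/subsetP => E; rewrite !inE (is_tree_edgesE r0) => /andP[/imsetP[p ap ->] PE].
by apply/imsetP; exists p; rewrite // inE ap.
Qed.

Lemma card_labelled_trees : #|labelled_trees n.+1| = #|arbos r0|.
Proof.
rewrite -(card_in_imset (@edges_inj _ r0)); apply: eq_card => E.
by rewrite inE (is_tree_edgesE r0).
Qed.

(** A quartic bound is enough, since the other estimates lose only a cubic factor. *)
Lemma growth_ge : (n.+1%:R * rate) ^+ 4 / 24 <= (theta R * xi) ^+ n.+1.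
Proof.
have tx0 : theta R * xi \is Num.pos by rewrite posrE mulr_gt0 ?theta_gt0 ?xi_gt0.
rewrite -[X in X ^+ n.+1]lnK // -expRM_natl -/rate.
apply: le_trans (expR_ge1Dxn 3 _); last by rewrite mulr_ge0 ?ler0n // ltW ?rate_gt0.
by rewrite lerDr ler01.
Qed.

(** The Stirling bound cancels the powers of [e] in [zcrit], and Cayley's bound then leaves a loss
    of [n.+1 ^ 3]. The quartic growth absorbs it with one factor [n.+1] to spare. *)
Lemma bad_ratio (b : nat) :
  b%:R * xi ^+ n.+1 <= (2 * n.+1)%:R * (n`!%:R / zcrit R ^+ n * expR (ycrit R)) ->
  b%:R * n.+1%:R <= tail_const * #|arbos r0|%:R.
Proof.
move=> hb; have N0 : 0 < (n.+1%:R : R) by rewrite ltr0n.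
have t0 := theta_gt0 R; have x0 := xi_gt0; have l0 := rate_gt0.
have Y0 : 0 < expR (ycrit R) := expR_gt0 _.
have h1 : b%:R * (theta R * xi) ^+ n.+1 <=
    theta R * (2 * n.+1%:R * n.+1%:R ^+ n.+1 * expR (ycrit R)).
  have hz : n`!%:R / zcrit R ^+ n * theta R ^+ n <= n.+1%:R ^+ n.+1.
    rewrite /zcrit expr_div_n invf_div mulrA divfK ?expf_neq0 ?gt_eqF //.
    exact: fact_exp_le.
  have -> : b%:R * (theta R * xi) ^+ n.+1 = theta R * (theta R ^+ n * (b%:R * xi ^+ n.+1)).
    rewrite exprMn (exprS (theta R)); move: (theta R ^+ n) (xi ^+ n.+1) (b%:R : R) => u v w.
    by ring.
  rewrite ler_pM2l //; apply: (le_trans (ler_wpM2l (exprn_ge0 _ (ltW t0)) hb)).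
  have -> : theta R ^+ n * ((2 * n.+1)%:R * (n`!%:R / zcrit R ^+ n * expR (ycrit R))) =
      2 * n.+1%:R * (n`!%:R / zcrit R ^+ n * theta R ^+ n) * expR (ycrit R).
    by rewrite natrM; move: (n`!%:R / _) (n.+1%:R : R) => u v; ring.
  by rewrite ler_pM2r // ler_pM2l // mulr_gt0.
have h2 : n.+1%:R ^+ n <= #|arbos r0|%:R * n.+1%:R :> R.
  by rewrite -natrX -natrM ler_nat; have := card_arbos r0; rewrite card_ord.
have h3 := growth_ge.
have h4 : b%:R * ((n.+1%:R * rate) ^+ 4 / 24) <=
    theta R * (2 * n.+1%:R * n.+1%:R ^+ n.+1 * expR (ycrit R)).
  by apply: le_trans h1; rewrite ler_wpM2l.
have h5 : theta R * (2 * n.+1%:R * n.+1%:R ^+ n.+1 * expR (ycrit R)) <=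
    theta R * (2 * n.+1%:R ^+ 3 * #|arbos r0|%:R * expR (ycrit R)).
  rewrite ler_pM2l // ler_pM2r //.
  have -> : 2 * n.+1%:R * n.+1%:R ^+ n.+1 = 2 * n.+1%:R ^+ 2 * n.+1%:R ^+ n :> R.
    by rewrite exprS -!mulrA.
  have -> : 2 * n.+1%:R ^+ 3 * #|arbos r0|%:R =
      2 * n.+1%:R ^+ 2 * (#|arbos r0|%:R * n.+1%:R) :> R.
    by move: (n.+1%:R : R) (#|arbos r0|%:R : R) => u v; ring.
  by rewrite ler_pM2l // mulr_gt0 ?exprn_gt0.
have h6 := le_trans h4 h5.
rewrite /tail_const mulrAC ler_pdivlMr ?exprn_gt0 //.
have c0 : 0 < n.+1%:R ^+ 3 / 24 :> R by rewrite divr_gt0 ?exprn_gt0.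
rewrite -(ler_pM2r c0).
move: h6; move: (n.+1%:R : R) (theta R) (expR _) (#|arbos r0|%:R : R) (b%:R : R) (rate).
move=> X T Y A' B' l h6; clear -h6; lra.
Qed.

Lemma prob_ge : 1 - tail_const / n.+1%:R <=
  uniform_prob R (labelled_trees n.+1) (fun E => (nb_subtrees E)%:R <= base ^+ n.+1).
Proof.
set P := fun E => _; have N0 : 0 < (n.+1%:R : R) by rewrite ltr0n.
have a0 : 0 < #|arbos r0|%:R :> R.
  rewrite ltr0n lt0n; apply/eqP => a0; have := card_arbos r0.
  by rewrite a0 mul0n leqn0 card_ord expn_eq0.
have hb : #|[set E in labelled_trees n.+1 | ~~ P E]|%:R * n.+1%:R <=
    tail_const * #|arbos r0|%:R.
  apply: bad_ratio; apply: le_trans bad_arbos.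
  apply: ler_wpM2r; first by rewrite exprn_ge0 ?(ltW xi_gt0).
  by rewrite ler_nat (bad_trees (fun E => ~~ P E)).
have cT : #|arbos r0|%:R = #|[set E in labelled_trees n.+1 | P E]|%:R +
    #|[set E in labelled_trees n.+1 | ~~ P E]|%:R :> R.
  rewrite -natrD -card_labelled_trees -(cardsID [set E | P E] (labelled_trees n.+1)).
  congr (_%:R); congr (_ + _)%N; apply: eq_card => E; rewrite !inE //.
  by rewrite andbC.
rewrite /uniform_prob card_labelled_trees ler_pdivlMr //.
rewrite mulrBl mul1r lerBlDr [X in X <= _]cT lerD2l mulrAC ler_pdivlMr //.
Qed.

End FixedSize.
End Concentration.

Lemma uniform_prob_le1 (R : realType) (T : finType) (Omega : {set T}) (P : pred T) :
  uniform_prob R Omega P <= 1.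
Proof.
rewrite /uniform_prob; have [->|a0] := posnP #|Omega|; first by rewrite invr0 mulr0.
rewrite ler_pdivrMr ?ltr0n // mul1r ler_nat; apply: subset_leq_card.
by apply/subsetP => x; rewrite inE => /andP[].
Qed.

Local Open Scope classical_set_scope.
Local Open Scope ring_scope.

Theorem theorem2p9 (R : realType) :
  (fun n : nat =>
     uniform_prob R (labelled_trees n)
       (fun E => (nb_subtrees E)%:R <= (141960%:R / 100000%:R : R) ^+ n))
  @ \oo --> (1 : R).
Proof.
(* The estimate concerns [n.+1] vertices; dropping the term [n = 0] does not affect the limit. *)
rewrite -cvg_shiftS /=.
apply: (@squeeze_cvgr _ _ _ _ (fun n => 1 - tail_const R * harmonic n) (fun=> 1)).
- by apply: nearW => n; apply/andP; split; [exact: prob_ge | exact: uniform_prob_le1].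
- rewrite -[X in _ --> X](subr0 (1 : R)) -(mulr0 (tail_const R)).
  by apply: cvgB; [exact: cvg_cst | apply: cvgMr; exact: cvg_harmonic].
- exact: cvg_cst.
Qed.
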